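(* Let $\mathcal C$ be a triangulated category endowed with a weight structure $w$, let $g:M\to N$ be a $\mathcal C$-morphism, and let $j\in\mathbb Z$. Then the following conditions are equivalent. 1. $g$ kills weight $j$. 2. $H^j_{\mathcal A}(g)=0$ for any pure cohomological functor $H_{\mathcal A}$ (corresponding to any additive contravariant functor $\mathcal A$ from $\underline{Hw}$ into any abelian category). 3. $H^j_{\mathcal A}(g)=0$ for any pure cohomological functor $H_{\mathcal A}$ corresponding to a contravariant additive functor $\mathcal A$ from $\underline{Hw}$ into $\mathrm{Ab}$ that converts all small $\underline{Hw}$-coproducts into products of groups. 4. $H_j^{\mathcal A}(g)=0$ for any pure homological functor $H^{\mathcal A}$ (corresponding to any additive covariant functor $\mathcal A$ from $\underline{Hw}$ into any abelian category).
   Context: Weight structures. A weight structure $w$ on a triangulated category $\mathcal C$ is a pair of classes $\mathcal C_{w\le 0},\mathcal C_{w\ge 0}\subset\operatorname{Obj}\mathcal C$ such that: (i) both are closed under retracts; (ii) $\mathcal C_{w\le 0}\subset\mathcal C_{w\le 0}[1]$ and $\mathcal C_{w\ge 0}[1]\subset\mathcal C_{w\ge 0}$; (iii) $\mathcal C(X,Y)=0$ for $X\in\mathcal C_{w\le 0}$, $Y\in\mathcal C_{w\ge 0}[1]$; (iv) every object $M$ fits into a distinguished triangle $LM\to M\to RM\to LM[1]$ with $LM\in\mathcal C_{w\le 0}$, $RM\in\mathcal C_{w\ge 0}[1]$. Put $\mathcal C_{w\ge i}=\mathcal C_{w\ge 0}[i]$, $\mathcal C_{w\le i}=\mathcal C_{w\le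 0}[i]$, $\mathcal C_{w=i}=\mathcal C_{w\ge i}\cap\mathcal C_{w\le i}$. The heart $\underline{Hw}$ is the full subcategory of $\mathcal C$ with object class $\mathcal C_{w=0}$. An $m$-weight decomposition of $M$ is a (non-canonical) distinguished triangle $w_{\le m}M\to M\to w_{\ge m+1}M\to (w_{\le m}M)[1]$ with $w_{\le m}M\in\mathcal C_{w\le m}$ and $w_{\ge m+1}M\in\mathcal C_{w\ge m+1}$. A morphism $g:M\to N$ kills weight $j$ if for some choice of a $j$-weight decomposition of $M$ and a $(j-1)$-weight decomposition of $N$ the composition $w_{\le j}M\to M\xrightarrow{g}N\to w_{\ge j}N$ is zero (this does not depend on the choices). Weight complexes. Chain maps $m_1,m_2:A\to B$ of complexes over an additive category $\mathcal B$ are weakly homotopic if $m_1-m_2=d_Bx+yd_A$ for some collections $x^*,y^*$ of morphisms $A^*\to B^{*-1}$; $K_{\mathfrak w}(\mathcal B)$ is the quotient of the homotopy category $K(\mathcal B)$ of cohomological complexes by this relation. For each $M$ fix weight decompositions with first arrows $c_n:w_{\le n}M\to M$, $n\in\mathbb Z$. There is a unique $g_n:w_{\le n}M\to w_{\le n+1}M$ with $c_{n+1}g_n=c_n$. Fix distinguished triangles $w_{\le n-1}M\xrightarrow{g_{n-1}}w_{\le n}M\to M^{-n}[n]\to(w_{\le n-1}M)[1]$; then $M^{-n}\in\mathcal C_{w=0}$, and the compositions $M^{-n}[n]\to(w_{\le n-1}M)[1]\to M^{1-n}[n]$, shifted by $[-n]$, are the differentials of the complex $t(M)=(M^i)$.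 For $f:M\to M'$ choose $f_{\le n}:w_{\le n}M\to w_{\le n}M'$ compatible with $f$ (these are automatically compatible with the $g_n$) and complete them to morphisms of the triangles above; the third components, shifted by $[-n]$, form a chain map $t(M)\to t(M')$ whose class in $K_{\mathfrak w}(\underline{Hw})$ does not depend on the choices made for $f$. This gives an additive functor $t:\mathcal C\to K_{\mathfrak w}(\underline{Hw})$, well-defined up to isomorphism. Pure functors. A homological or cohomological functor from $\mathcal C$ into an abelian category is pure if it kills $\mathcal C_{w\ge 1}$ and $\mathcal C_{w\le -1}$. For an additive covariant $\mathcal A$ from $\underline{Hw}$ into an abelian category, $H^{\mathcal A}$ sends $M$, with $t(M)=(M^i)$, to the zeroth homology of the complex $(\mathcal A(M^i))_i$; for an additive contravariant $\mathcal A$, $H_{\mathcal A}$ sends $M$ to the zeroth homology of the complex $(\mathcal A(M^{-i}))_i$. These are well-defined pure homological (resp. cohomological) functors, and all pure functors are of this form. For a homological (resp. cohomological) $H$ write $H_j$ (resp. $H^j$) for $H\circ[-j]$; $H_j^{\mathcal A}$ and $H^j_{\mathcal A}$ are the corresponding shifts of $H^{\mathcal A}$ and $H_{\mathcal A}$. *)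

(* Defs.v *)
From HB Require Import structures.
From mathcomp Require Import all_boot all_order all_algebra.
From mathcomp Require Import boolp.
From mathcomp Require Import zify.

Set Implicit Arguments.
Unset Strict Implicit.
Unset Printing Implicit Defensive.

Import GRing.Theory.
Local Open Scope ring_scope.

Declare Scope cat_scope.
Delimit Scope cat_scope with cat.
Local Open Scope cat_scope.

Record precat := Precat {
  ob :> Type;
  mor : ob -> ob -> zmodType;
  idm : forall X, mor X X;
  mcomp : forall X Y Z, mor Y Z -> mor X Y -> mor X Z;
  comp1m : forall X Y (f : mor X Y), mcomp (idm Y) f = f;
  compm1 : forall X Y (f : mor X Y), mcomp f (idm X) = f;
  mcompA : forall X Y Z T (h : mor Z T) (g : mor Y Z) (f : mor X Y),
    mcomp h (mcomp g f) = mcomp (mcomp h g) f;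
  compDl : forall X Y Z (g1 g2 : mor Y Z) (f : mor X Y),
    mcomp (g1 + g2) f = mcomp g1 f + mcomp g2 f;
  compDr : forall X Y Z (g : mor Y Z) (f1 f2 : mor X Y),
    mcomp g (f1 + f2) = mcomp g f1 + mcomp g f2
}.
Arguments idm {p} X.

Notation "g '∘' f" := (mcomp g f) (at level 40, left associativity) : cat_scope.

Section PrecatTheory.
Variable C : precat.

Lemma comp0m (X Y Z : C) (f : mor X Y) : (0 : mor Y Z) ∘ f = 0.
Proof. by apply: (addrI (0 ∘ f)); rewrite -compDl !addr0. Qed.

Lemma compm0 (X Y Z : C) (g : mor Y Z) : g ∘ (0 : mor X Y) = 0.
Proof. by apply: (addrI (g ∘ 0)); rewrite -compDr !addr0. Qed.

Lemma compNl (X Y Z : C) (g : mor Y Z) (f : mor X Y) : (- g) ∘ f = - (g ∘ f).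
Proof. by apply: (addrI (g ∘ f)); rewrite -compDl !subrr comp0m. Qed.

Lemma compNr (X Y Z : C) (g : mor Y Z) (f : mor X Y) : g ∘ (- f) = - (g ∘ f).
Proof. by apply: (addrI (g ∘ f)); rewrite -compDr !subrr compm0. Qed.

Lemma compBl (X Y Z : C) (g1 g2 : mor Y Z) (f : mor X Y) :
  (g1 - g2) ∘ f = g1 ∘ f - g2 ∘ f.
Proof. by rewrite compDl compNl. Qed.

Lemma compBr (X Y Z : C) (g : mor Y Z) (f1 f2 : mor X Y) :
  g ∘ (f1 - f2) = g ∘ f1 - g ∘ f2.
Proof. by rewrite compDr compNr. Qed.
End PrecatTheory.

Definition opcat (C : precat) : precat :=
  @Precat C (fun X Y => @mor C Y X) (fun X => idm X)
    (fun X Y Z g f => f ∘ g)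
    (fun X Y f => compm1 f) (fun X Y f => comp1m f)
    (fun X Y Z T h g f => esym (mcompA f g h))
    (fun X Y Z g1 g2 f => compDr f g1 g2)
    (fun X Y Z g f1 f2 => compDl f1 f2 g).

Record add_functor (C D : precat) := AddFunctor {
  fob :> C -> D;
  fmap : forall X Y, mor X Y -> mor (fob X) (fob Y);
  fmap1 : forall X, fmap (idm X) = idm (fob X);
  fmapM : forall X Y Z (g : mor Y Z) (f : mor X Y),
    fmap (g ∘ f) = fmap g ∘ fmap f;
  fmapD : forall X Y (f g : mor X Y), fmap (f + g) = fmap f + fmap g
}.
Arguments fmap {C D} F {X Y} f : rename.

Definition id_functor (C : precat) : add_functor C C :=
  @AddFunctor C C (fun X => X) (fun X Y f => f) (fun _ => erefl)
    (fun _ _ _ _ _ => erefl) (fun _ _ _ _ => erefl).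

Program Definition comp_functor (C D E : precat)
    (G : add_functor D E) (F : add_functor C D) : add_functor C E :=
  @AddFunctor C E (fun X => G (F X)) (fun X Y f => fmap G (fmap F f)) _ _ _.
Next Obligation. by move=> *; rewrite !fmap1. Qed.
Next Obligation. by move=> *; rewrite !fmapM. Qed.
Next Obligation. by move=> *; rewrite !fmapD. Qed.

Definition is_iso (C : precat) (X Y : C) (f : mor X Y) : Prop :=
  exists g : mor Y X, g ∘ f = idm X /\ f ∘ g = idm Y.

Definition isomorphic (C : precat) (X Y : C) : Prop :=
  exists f : mor X Y, is_iso f.

Definition retract_of (C : precat) (X Y : C) : Prop :=
  exists (i : mor X Y) (p : mor Y X), p ∘ i = idm X.

Record natiso (C D : precat) (F G : add_functor C D) := NatIso {
  nt :> forall X, mor (F X) (G X);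
  nt_natural : forall X Y (f : mor X Y), nt Y ∘ fmap F f = fmap G f ∘ nt X;
  nt_iso : forall X, is_iso (nt X)
}.

Definition is_zero (C : precat) (Z : C) : Prop := idm Z = 0.

Definition is_biproduct (C : precat) (X Y P : C)
    (i1 : mor X P) (i2 : mor Y P) (p1 : mor P X) (p2 : mor P Y) : Prop :=
  [/\ p1 ∘ i1 = idm X, p2 ∘ i2 = idm Y, p1 ∘ i2 = 0, p2 ∘ i1 = 0
    & i1 ∘ p1 + i2 ∘ p2 = idm P].

Definition is_additive_cat (C : precat) : Prop :=
  (exists Z : C, is_zero Z) /\
  forall X Y : C, exists (P : C) (i1 : mor X P) (i2 : mor Y P)
    (p1 : mor P X) (p2 : mor P Y), is_biproduct i1 i2 p1 p2.

Definition is_product (C : precat) (I : Type) (X : I -> C) (P : C)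
    (p : forall i, mor P (X i)) : Prop :=
  forall (T : C) (f : forall i, mor T (X i)),
    exists! u : mor T P, forall i, p i ∘ u = f i.

Definition is_coproduct (C : precat) (I : Type) (X : I -> C) (P : C)
    (j : forall i, mor (X i) P) : Prop :=
  @is_product (opcat C) I X P j.

Definition is_kernel (C : precat) (K X Y : C) (f : mor X Y) (k : mor K X)
  : Prop :=
  f ∘ k = 0 /\
  forall (T : C) (h : mor T X), f ∘ h = 0 -> exists! u : mor T K, k ∘ u = h.

Definition is_cokernel (C : precat) (X Y Q : C) (f : mor X Y) (q : mor Y Q)
  : Prop :=
  q ∘ f = 0 /\
  forall (T : C) (h : mor Y T), h ∘ f = 0 -> exists! u : mor Q T, u ∘ q = h.

Definition is_mono (C : precat) (X Y : C) (f : mor X Y) : Prop :=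
  forall (T : C) (g1 g2 : mor T X), f ∘ g1 = f ∘ g2 -> g1 = g2.

Definition is_epi (C : precat) (X Y : C) (f : mor X Y) : Prop :=
  forall (T : C) (g1 g2 : mor Y T), g1 ∘ f = g2 ∘ f -> g1 = g2.

Record abelian := Abelian {
  ab_cat :> precat;
  ab_additive : is_additive_cat ab_cat;
  ab_kernel : forall (X Y : ab_cat) (f : mor X Y),
    exists (K : ab_cat) (k : mor K X), is_kernel f k;
  ab_cokernel : forall (X Y : ab_cat) (f : mor X Y),
    exists (Q : ab_cat) (q : mor Y Q), is_cokernel f q;
  ab_mono : forall (X Y : ab_cat) (f : mor X Y), is_mono f ->
    exists (Z : ab_cat) (g : mor Y Z), is_kernel g f;
  ab_epi : forall (X Y : ab_cat) (f : mor X Y), is_epi f ->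
    exists (Z : ab_cat) (g : mor Z X), is_cokernel g f
}.

Section Homology.
Variable A : abelian.

Section Kernels.
Variables (X Y : A) (f : mor X Y).

Definition kern : A := sval (cid (ab_kernel f)).
Definition kerm : mor kern X := sval (cid (svalP (cid (ab_kernel f)))).
Lemma kermP : is_kernel f kerm.
Proof. exact: svalP (cid (svalP (cid (ab_kernel f)))). Qed.

Definition cokern : A := sval (cid (ab_cokernel f)).
Definition cokerm : mor Y cokern := sval (cid (svalP (cid (ab_cokernel f)))).
Lemma cokermP : is_cokernel f cokerm.
Proof. exact: svalP (cid (svalP (cid (ab_cokernel f)))). Qed.

Definition ker_lift T (h : mor T X) (e : f ∘ h = 0) : mor T kern :=
  sval (cid (kermP.2 T h e)).
Lemma ker_liftE T (h : mor T X) (e : f ∘ h = 0) : kerm ∘ ker_lift e = h.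
Proof. by rewrite /ker_lift; case: cid => u []. Qed.

Definition coker_desc T (h : mor Y T) (e : h ∘ f = 0) : mor cokern T :=
  sval (cid (cokermP.2 T h e)).
Lemma coker_descE T (h : mor Y T) (e : h ∘ f = 0) : coker_desc e ∘ cokerm = h.
Proof. by rewrite /coker_desc; case: cid => u []. Qed.
End Kernels.

Lemma kerm_mono (X Y : A) (f : mor X Y) : is_mono (kerm f).
Proof.
move=> T g1 g2 E.
have z : f ∘ (kerm f ∘ g2) = 0 by rewrite mcompA (kermP f).1 comp0m.
case: ((kermP f).2 T _ z) => u [_ U].
by rewrite -(U _ E) -(U g2 erefl).
Qed.

Definition homology X Y Z (f : mor X Y) (g : mor Y Z) (e : g ∘ f = 0) : A :=
  cokern (ker_lift e).

Section Map.
Variables (X Y Z X' Y' Z' : A).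
Variables (f : mor X Y) (g : mor Y Z) (e : g ∘ f = 0).
Variables (f' : mor X' Y') (g' : mor Y' Z') (e' : g' ∘ f' = 0).
Variables (a : mor X X') (b : mor Y Y') (c : mor Z Z').
Hypotheses (ef : b ∘ f = f' ∘ a) (eg : c ∘ g = g' ∘ b).

Lemma cycles_map_subproof : g' ∘ (b ∘ kerm g) = 0.
Proof. by rewrite mcompA -eg -mcompA (kermP g).1 compm0. Qed.

Definition cycles_map : mor (kern g) (kern g') := ker_lift cycles_map_subproof.

Lemma homology_map_subproof :
  cokerm (ker_lift e') ∘ cycles_map ∘ ker_lift e = 0.
Proof.
have -> : cokerm (ker_lift e') ∘ cycles_map ∘ ker_lift e
        = cokerm (ker_lift e') ∘ ker_lift e' ∘ a.
  rewrite -!mcompA; congr (_ ∘ _); apply: kerm_mono.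
  by rewrite !mcompA !ker_liftE -mcompA ker_liftE.
by rewrite (cokermP _).1 comp0m.
Qed.

Definition homology_map : mor (homology e) (homology e') :=
  coker_desc homology_map_subproof.
End Map.

End Homology.

Section AbHom.
Variables U V : zmodType.
Implicit Types f g h : {additive U -> V}.

Lemma additive_eq f g : f =1 g -> f = g.
Proof.
move: f g => [f [[Hf]]] [g [[Hg]]] /= /funext E.
case: _ / E in Hg *.
by congr (GRing.Additive.Pack (GRing.Additive.Class _)); congr (_ _); exact: Prop_irrelevance.
Qed.

HB.instance Definition _ := gen_eqMixin {additive U -> V}.
HB.instance Definition _ := gen_choiceMixin {additive U -> V}.

Definition ab_zero : {additive U -> V} := \0%R.
Definition ab_opp f : {additive U -> V} := (\- f)%R.
Definition ab_add f g : {additive U -> V} := (f \+ g)%R.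

Fact ab_addA : associative ab_add.
Proof. by move=> f g h; apply: additive_eq => x; rewrite /= addrA. Qed.
Fact ab_addC : commutative ab_add.
Proof. by move=> f g; apply: additive_eq => x; rewrite /= addrC. Qed.
Fact ab_add0 : left_id ab_zero ab_add.
Proof. by move=> f; apply: additive_eq => x; rewrite /= add0r. Qed.
Fact ab_addN : left_inverse ab_zero ab_opp ab_add.
Proof. by move=> f; apply: additive_eq => x; rewrite /= addNr. Qed.

HB.instance Definition _ := GRing.isZmodule.Build {additive U -> V}
  ab_addA ab_addC ab_add0 ab_addN.
End AbHom.

Program Definition ab_precat : precat :=
  @Precat zmodType (fun U V => {additive U -> V} : zmodType)
    (fun U => idfun : {additive U -> U})
    (fun U V W g f => (g \o f)%FUN : {additive U -> W}) _ _ _ _ _.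
Next Obligation. by apply: additive_eq. Qed.
Next Obligation. by apply: additive_eq. Qed.
Next Obligation. by apply: additive_eq. Qed.
Next Obligation. by apply: additive_eq. Qed.
Next Obligation. by apply: additive_eq => x /=; rewrite raddfD. Qed.

Section MkAdditive.
Variables (U V : zmodType) (f : U -> V) (fB : zmod_morphism f).
Definition mk_additive_fun & zmod_morphism f := f.
HB.instance Definition _ :=
  GRing.isZmodMorphism.Build U V (mk_additive_fun fB) fB.
Definition mk_additive : {additive U -> V} := mk_additive_fun fB.
End MkAdditive.

Section AbKernel.
Variables (U V : zmodType) (f : {additive U -> V}).

Definition ab_kerp : {pred U} := fun x => f x == 0.
Lemma ab_kerpE x : (x \in ab_kerp) = (f x == 0).
Proof. by []. Qed.

Fact ab_kerp_closed : zmod_closed ab_kerp.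
Proof.
split=> [|x y]; first by rewrite ab_kerpE raddf0.
by rewrite !ab_kerpE raddfB => /eqP -> /eqP ->; rewrite subr0.
Qed.
HB.instance Definition _ := GRing.isZmodClosed.Build U ab_kerp ab_kerp_closed.

Record ab_ker := AbKer { ab_kerval :> U; ab_kervalP : ab_kerval \in ab_kerp }.
HB.instance Definition _ := [isSub for ab_kerval].
HB.instance Definition _ := [Choice of ab_ker by <:].
HB.instance Definition _ := [SubChoice_isSubZmodule of ab_ker by <:].

Lemma ab_ker_is_kernel :
  @is_kernel ab_precat ab_ker U V f (val : {additive ab_ker -> U}).
Proof.
split; first by apply: additive_eq => -[x /= /eqP].
move=> T h fh0.
have k x : h x \in ab_kerp.
  by have := congr1 (fun g : {additive T -> V} => g x) fh0 => /= /eqP.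
pose u x := AbKer (k x).
have uB : zmod_morphism u by move=> x y; apply: val_inj; rewrite /= !raddfB.
exists (mk_additive uB); split; first exact: additive_eq.
by move=> v E; apply: additive_eq => x; apply: val_inj; rewrite /= -E.
Qed.

Definition ab_imp : {pred V} := fun y => `[< exists x, f x = y >].
Fact ab_imp_closed : zmod_closed ab_imp.
Proof.
split=> [|_ _ /asboolP[x <-] /asboolP[y <-]]; apply/asboolP.
  by exists 0; rewrite raddf0.
by exists (x - y); rewrite raddfB.
Qed.
HB.instance Definition _ := GRing.isZmodClosed.Build V ab_imp ab_imp_closed.

Definition ab_coker : zmodType := Quotient.quot ab_imp.
Definition ab_pi : {additive V -> ab_coker} := \pi_(Quotient.quot ab_imp)%qT.

Lemma ab_pi_eq0 y : ab_pi y = 0 <-> exists x, f x = y.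
Proof.
have -> : 0 = ab_pi 0 by rewrite raddf0.
split=> [/eqP|E].
  by rewrite -Quotient.idealrBE subr0 => /asboolP.
by apply/eqP; rewrite -Quotient.idealrBE subr0; apply/asboolP.
Qed.

Lemma ab_pi_surj z : exists y, ab_pi y = z.
Proof. by exists (repr z); rewrite /ab_pi /= reprK. Qed.

Lemma ab_coker_is_cokernel : @is_cokernel ab_precat U V ab_coker f ab_pi.
Proof.
split; first by apply: additive_eq => x; apply/ab_pi_eq0; exists x.
move=> T h hf0.
have hf x : h (f x) = 0.
  exact: (congr1 (fun g : {additive U -> T} => g x) hf0).
pose u (z : ab_coker) := h (repr z).
have uE y : u (ab_pi y) = h y.
  apply/eqP; rewrite -subr_eq0 -raddfB.
  have /ab_pi_eq0[x <-] : ab_pi (repr (ab_pi y) - y) = 0.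
    by rewrite raddfB /ab_pi /= reprK subrr.
  by rewrite hf.
have uB : zmod_morphism u.
  move=> z1 z2; have [y1 <-] := ab_pi_surj z1; have [y2 <-] := ab_pi_surj z2.
  by rewrite -raddfB !uE raddfB.
exists (mk_additive uB); split; first by apply: additive_eq => x; apply: uE.
move=> v E; apply: additive_eq => z; have [y <-] := ab_pi_surj z.
exact: etrans (uE y) (esym (congr1 (fun g : {additive _ -> _} => g y) E)).
Qed.
End AbKernel.

Lemma ab_precat_additive : is_additive_cat ab_precat.
Proof.
split; first by exists ('I_1 : zmodType); apply: additive_eq => x; rewrite /= !ord1.
rewrite /= => U V; exists ((U * V)%type : zmodType).
have l1 : zmod_morphism (fun x : U => (x, 0 : V)).
  by move=> x y; congr (_, _); rewrite subrr.
have l2 : zmod_morphism (fun y : V => (0 : U, y)).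
  by move=> x y; congr (_, _); rewrite subrr.
exists (mk_additive l1), (mk_additive l2).
exists (fst : {additive (U * V)%type -> U}).
exists (snd : {additive (U * V)%type -> V}).
split; apply: additive_eq => //= -[x y].
by congr (_, _); rewrite /= ?addr0 ?add0r.
Qed.

Lemma ab_mono_inj (U V : ab_precat) (f : mor U V) : is_mono f -> injective (f : {additive _ -> _}).
Proof.
move=> m x y E; apply/eqP; rewrite -subr_eq0.
have k : (x - y) \in ab_kerp f by rewrite ab_kerpE raddfB E subrr.
have V0 : (val : {additive ab_ker f -> U}) = 0.
  by apply: (m (ab_ker f)); rewrite compm0; case: (ab_ker_is_kernel f).
by have /= -> := congr1 (fun g : {additive _ -> _} => g (AbKer k)) V0.
Qed.

Lemma ab_epi_surj (U V : ab_precat) (f : mor U V) : is_epi f ->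
  forall y : V, exists x, (f : {additive U -> V}) x = y.
Proof.
move=> ep y; apply/ab_pi_eq0.
have P0 : ab_pi f = 0.
  by apply: (ep (ab_coker f)); rewrite comp0m; case: (ab_coker_is_cokernel f).
by rewrite P0.
Qed.

Lemma ab_mono_kernel (U V : ab_precat) (f : mor U V) : is_mono f ->
  exists (W : ab_precat) (g : mor V W), is_kernel g f.
Proof.
move=> mf; have fI := ab_mono_inj mf.
exists (ab_coker f), (ab_pi f); split; first by case: (ab_coker_is_cokernel f).
move=> T h h0.
have ex z : exists x, (f : {additive U -> V}) x = (h : {additive T -> V}) z.
  apply/ab_pi_eq0; exact: (congr1 (fun g : {additive _ -> _} => g z) h0).
pose u z := sval (cid (ex z)).
have uE z : (f : {additive U -> V}) (u z) = (h : {additive T -> V}) z.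
  by rewrite /u; case: cid.
have uB : zmod_morphism u by move=> x y; apply: fI; rewrite raddfB !uE raddfB.
exists (mk_additive uB); split; first by apply: additive_eq => z; apply: uE.
by move=> v E; apply: additive_eq => z; apply: fI; exact: etrans (uE z) (esym (congr1 (fun g : {additive _ -> _} => g z) E)).
Qed.

Lemma ab_epi_cokernel (U V : ab_precat) (f : mor U V) : is_epi f ->
  exists (W : ab_precat) (g : mor W U), is_cokernel g f.
Proof.
move=> /ab_epi_surj fS.
exists (ab_ker f : zmodType), (val : {additive ab_ker f -> U}); split.
  by case: (ab_ker_is_kernel f).
move=> T h h0.
pose u z := (h : {additive U -> T}) (sval (cid (fS z))).
have uE x : u ((f : {additive U -> V}) x) = (h : {additive U -> T}) x.
  rewrite /u; case: cid => x' /= E; apply/eqP; rewrite -subr_eq0 -raddfB.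
  have k : (x' - x) \in ab_kerp f by rewrite ab_kerpE raddfB E subrr.
  by have /= -> := congr1 (fun g : {additive _ -> _} => g (AbKer k)) h0.
have uB : zmod_morphism u.
  move=> z1 z2; have [y1 <-] := fS z1; have [y2 <-] := fS z2.
  by rewrite -raddfB !uE raddfB.
exists (mk_additive uB); split; first by apply: additive_eq => x; apply: uE.
move=> v E; apply: additive_eq => z; have [y <-] := fS z.
exact: etrans (uE y) (esym (congr1 (fun g : {additive _ -> _} => g y) E)).
Qed.

Definition Ab : abelian :=
  @Abelian ab_precat ab_precat_additive
    (fun U V f => ex_intro _ _ (ex_intro _ _ (ab_ker_is_kernel f)))
    (fun U V f => ex_intro _ _ (ex_intro _ _ (ab_coker_is_cokernel f)))
    (@ab_mono_kernel) (@ab_epi_cokernel).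

(* The shift is an additive auto-equivalence [tsh] with a chosen quasi-inverse
   [tshV]; the case of an automorphism is the one where [tunit] and [tcounit]
   are identities. [dist f g h] means that X -f-> Y -g-> Z -h-> X[1] is a
   distinguished triangle. *)
Record tricat := TriCat {
  tcat :> precat;
  tadditive : is_additive_cat tcat;
  tsh : add_functor tcat tcat;
  tshV : add_functor tcat tcat;
  tunit : natiso (id_functor tcat) (comp_functor tshV tsh);
  tcounit : natiso (comp_functor tsh tshV) (id_functor tcat);
  dist : forall X Y Z : tcat,
    mor X Y -> mor Y Z -> mor Z (tsh X) -> Prop;
  dist_iso : forall (X Y Z X' Y' Z' : tcat)
    (f : mor X Y) (g : mor Y Z) (h : mor Z (tsh X))
    (f' : mor X' Y') (g' : mor Y' Z') (h' : mor Z' (tsh X'))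
    (a : mor X X') (b : mor Y Y') (c : mor Z Z'),
    is_iso a -> is_iso b -> is_iso c ->
    b ∘ f = f' ∘ a -> c ∘ g = g' ∘ b -> fmap tsh a ∘ h = h' ∘ c ->
    dist f g h -> dist f' g' h';
  dist_id : forall X Z : tcat, is_zero Z ->
    dist (idm X) (0 : mor X Z) (0 : mor Z (tsh X));
  dist_cone : forall (X Y : tcat) (f : mor X Y),
    exists (Z : tcat) (g : mor Y Z) (h : mor Z (tsh X)), dist f g h;
  dist_rot : forall (X Y Z : tcat)
    (f : mor X Y) (g : mor Y Z) (h : mor Z (tsh X)),
    dist f g h <-> dist g h (- fmap tsh f);
  dist_fill : forall (X Y Z X' Y' Z' : tcat)
    (f : mor X Y) (g : mor Y Z) (h : mor Z (tsh X))
    (f' : mor X' Y') (g' : mor Y' Z') (h' : mor Z' (tsh X'))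
    (a : mor X X') (b : mor Y Y'),
    dist f g h -> dist f' g' h' -> b ∘ f = f' ∘ a ->
    exists c : mor Z Z', c ∘ g = g' ∘ b /\ fmap tsh a ∘ h = h' ∘ c;
  dist_octahedron : forall (X Y Z Z' Y' X' : tcat)
    (u : mor X Y) (j : mor Y Z') (k : mor Z' (tsh X))
    (v : mor Y Z) (l : mor Z X') (i : mor X' (tsh Y))
    (m : mor Z Y') (n : mor Y' (tsh X)),
    dist u j k -> dist v l i -> dist (v ∘ u) m n ->
    exists (f : mor Z' Y') (g : mor Y' X'),
      [/\ dist f g (fmap tsh j ∘ i),
          f ∘ j = m ∘ v, n ∘ f = k, g ∘ m = l & i ∘ g = fmap tsh u ∘ n]
}.

Definition shift (C : tricat) (n : int) : add_functor C C :=
  match n with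
  | Posz k => iter k (comp_functor (tsh C)) (id_functor C)
  | Negz k => iter k.+1 (comp_functor (tshV C)) (id_functor C)
  end.

Section ShiftSucc.
Variable C : tricat.

Definition int_pred (n : int) : int :=
  match n with Posz 0 => Negz 0 | Posz k.+1 => Posz k | Negz k => Negz k.+1 end.

Lemma int_predE n : n - 1 = int_pred n.
Proof.
by case: n => [[|k]|k] //=; rewrite ?NegzE; lia.
Qed.

Definition shift_pred_iso (n : int) (X : C) :
    mor (tsh C (shift C (int_pred n) X)) (shift C n X) :=
  match n with
  | Posz 0 => tcounit C X
  | Posz k.+1 => idm _
  | Negz k => tcounit C (shift C (Negz k) X)
  end.

(* X[n-1][1] -> X[n] *)
Definition shift_succ (n : int) (X : C) :
    mor (tsh C (shift C (n - 1) X)) (shift C n X) :=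
  eq_rect (int_pred n)
    (fun m => mor (tsh C (shift C m X)) (shift C n X))
    (shift_pred_iso n X) (n - 1) (esym (int_predE n)).

End ShiftSucc.

(* The class P[n], closed under isomorphisms because the shift is only an
   auto-equivalence. *)
Definition shift_class (C : tricat) (P : C -> Prop) (n : int) : C -> Prop :=
  fun X => exists Y : C, P Y /\ isomorphic X (shift C n Y).

Record weight_structure (C : tricat) := WeightStructure {
  w_le0 : C -> Prop;
  w_ge0 : C -> Prop;
  w_le0_retract : forall X Y : C, retract_of X Y -> w_le0 Y -> w_le0 X;
  w_ge0_retract : forall X Y : C, retract_of X Y -> w_ge0 Y -> w_ge0 X;
  w_le0_shift : forall X : C, w_le0 X -> shift_class w_le0 1 X;
  w_ge0_shift : forall X : C, shift_class w_ge0 1 X -> w_ge0 X;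
  w_orth : forall (X Y : C) (f : mor X Y),
    w_le0 X -> shift_class w_ge0 1 Y -> f = 0;
  w_decomp : forall M : C, exists (L R : C)
    (a : mor L M) (b : mor M R) (c : mor R (tsh C L)),
    [/\ dist a b c, w_le0 L & shift_class w_ge0 1 R]
}.

Section Weights.
Variables (C : tricat) (w : weight_structure C).

Definition w_le (n : int) : C -> Prop := shift_class (w_le0 w) n.
Definition w_ge (n : int) : C -> Prop := shift_class (w_ge0 w) n.
Definition w_eq (n : int) : C -> Prop := fun X => w_ge n X /\ w_le n X.

Definition full_subcat (P : C -> Prop) : precat :=
  @Precat {X : C | P X} (fun X Y => mor (sval X) (sval Y))
    (fun X => idm (sval X)) (fun _ _ _ g f => g ∘ f)
    (fun _ _ f => comp1m f) (fun _ _ f => compm1 f)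
    (fun _ _ _ _ h g f => mcompA h g f)
    (fun _ _ _ g1 g2 f => compDl g1 g2 f)
    (fun _ _ _ g f1 f2 => compDr g f1 f2).

Definition heart : precat := full_subcat (w_eq 0).

Definition heart_incl : add_functor heart C :=
  @AddFunctor heart C (fun X => sval X) (fun X Y f => f) (fun _ => erefl)
    (fun _ _ _ _ _ => erefl) (fun _ _ _ _ => erefl).

Definition is_weight_decomp (m : int) (M L R : C)
    (a : mor L M) (b : mor M R) (c : mor R (tsh C L)) : Prop :=
  [/\ dist a b c, w_le m L & w_ge (m + 1) R].

Definition kills_weight (j : int) (M N : C) (g : mor M N) : Prop :=
  exists (L R L' R' : C)
    (a : mor L M) (b : mor M R) (c : mor R (tsh C L))
    (a' : mor L' N) (b' : mor N R') (c' : mor R' (tsh C L')),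
    [/\ is_weight_decomp j a b c, is_weight_decomp (j - 1) a' b' c'
      & b' ∘ g ∘ a = 0].

(* [wc_trunc n] is w_{<=n}M, with the arrow [wc_arr n] to M, and [wc_term n]
   is the term M^{-n} of t(M): the terms are indexed by the weight n, i.e.
   homologically, which makes [wc_d n] the differential M^{-n} -> M^{1-n}. *)
Record weight_complex (M : C) := WeightComplex {
  wc_trunc : int -> C;
  wc_arr : forall n, mor (wc_trunc n) M;
  wc_arrP : forall n, exists (R : C) (b : mor M R)
    (c : mor R (tsh C (wc_trunc n))), is_weight_decomp n (wc_arr n) b c;
  wc_g : forall n, mor (wc_trunc (n - 1)) (wc_trunc n);
  wc_gE : forall n, wc_arr n ∘ wc_g n = wc_arr (n - 1);
  wc_term : int -> heart;
  wc_p : forall n, mor (wc_trunc n) (shift C n (heart_incl (wc_term n)));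
  wc_q : forall n,
    mor (shift C n (heart_incl (wc_term n))) (tsh C (wc_trunc (n - 1)));
  wc_dist : forall n, dist (wc_g n) (wc_p n) (wc_q n);
  (* [wc_d n] is the unique morphism whose shift by [n] is the composition
     M^{-n}[n] -> w_{<=n-1}M[1] -> M^{1-n}[n-1][1] = M^{1-n}[n]. *)
  wc_d : forall n, mor (wc_term n) (wc_term (n - 1));
  wc_dE : forall n, fmap (shift C n) (fmap heart_incl (wc_d n)) =
    shift_succ n (heart_incl (wc_term (n - 1)))
      ∘ fmap (tsh C) (wc_p (n - 1)) ∘ wc_q n
}.

Record weight_complex_map (M N : C) (S : weight_complex M)
    (T : weight_complex N) (f : mor M N) := WeightComplexMap {
  wm_trunc : forall n, mor (wc_trunc S n) (wc_trunc T n);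
  wm_arr : forall n, wc_arr T n ∘ wm_trunc n = f ∘ wc_arr S n;
  wm_term : forall n, mor (wc_term S n) (wc_term T n);
  wm_p : forall n,
    fmap (shift C n) (fmap heart_incl (wm_term n)) ∘ wc_p S n
    = wc_p T n ∘ wm_trunc n;
  wm_q : forall n,
    wc_q T n ∘ fmap (shift C n) (fmap heart_incl (wm_term n))
    = fmap (tsh C) (wm_trunc (n - 1)) ∘ wc_q S n
}.

(* All the choices made to obtain the functor t; the compatibility of [wm_trunc]
   with [wc_g] and the fact that [wm_term] is a chain map are automatic. *)
Record weight_complex_choice := WeightComplexChoice {
  wcc_obj : forall M : C, weight_complex M;
  wcc_map : forall (M N : C) (f : mor M N),
    weight_complex_map (wcc_obj M) (wcc_obj N) f
}.
End Weights.

Section TriTheory.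
Variable C : tricat.

Lemma fmap0 (D E : precat) (F : add_functor D E) (X Y : D) :
  fmap F (0 : mor X Y) = 0.
Proof. by apply: (addrI (fmap F 0)); rewrite -fmapD !addr0. Qed.

Lemma fmapN (D E : precat) (F : add_functor D E) (X Y : D) (f : mor X Y) :
  fmap F (- f) = - fmap F f.
Proof. by apply: (addrI (fmap F f)); rewrite -fmapD !subrr fmap0. Qed.

Lemma is_iso_monoL (D : precat) (X Y Z : D) (f : mor Y Z) (g1 g2 : mor X Y) :
  is_iso f -> f ∘ g1 = f ∘ g2 -> g1 = g2.
Proof.
by case=> g [gf _] E; rewrite -(comp1m g1) -(comp1m g2) -gf -!mcompA E.
Qed.

Lemma is_iso_epiR (D : precat) (X Y Z : D) (f : mor X Y) (g1 g2 : mor Y Z) :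
  is_iso f -> g1 ∘ f = g2 ∘ f -> g1 = g2.
Proof.
by case=> g [_ fg] E; rewrite -(compm1 g1) -(compm1 g2) -fg !mcompA E.
Qed.

Lemma tsh_inj (X Y : C) (f g : mor X Y) :
  fmap (tsh C) f = fmap (tsh C) g -> f = g.
Proof.
move=> E; apply: (is_iso_monoL (nt_iso (tunit C) Y)).
have := nt_natural (tunit C) f; have := nt_natural (tunit C) g.
by rewrite /= E => <- <-.
Qed.

Lemma tshV_inj (X Y : C) (f g : mor X Y) :
  fmap (tshV C) f = fmap (tshV C) g -> f = g.
Proof.
move=> E; apply: (is_iso_epiR (nt_iso (tcounit C) X)).
have := nt_natural (tcounit C) f; have := nt_natural (tcounit C) g.
by rewrite /= E => -> ->.
Qed.

Lemma shift_inj n (X Y : C) (f g : mor X Y) :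
  fmap (shift C n) f = fmap (shift C n) g -> f = g.
Proof.
case: n => k /=; first by elim: k f g => [|k IH] f g //= /tsh_inj/IH.
by move/tshV_inj; elim: k f g => [|k IH] f g //= /tshV_inj/IH.
Qed.

Lemma shift_succ_natural n (X Y : C) (f : mor X Y) :
  fmap (shift C n) f ∘ shift_succ n X
  = shift_succ n Y ∘ fmap (tsh C) (fmap (shift C (n - 1)) f).
Proof.
rewrite /shift_succ; move: (esym (int_predE n)).
move: (n - 1) => m e; case: m / e => /=.
case: n => [[|k]|k] /=.
- exact: (esym (nt_natural (tcounit C) f)).
- by rewrite compm1 comp1m.
- exact: (esym (nt_natural (tcounit C) (fmap (shift C (Negz k)) f))).
Qed.

Lemma dist_comp0 (X Y Z : C) (f : mor X Y) (g : mor Y Z) (h : mor Z (tsh C X)) :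
  dist f g h -> g ∘ f = 0.
Proof.
have [[Z0 Z0P] _] := tadditive C.
move=> D; have [|c [E _]] := dist_fill (a := idm X) (b := f) (dist_id X Z0P) D.
  by rewrite compm1.
by rewrite -E compm0.
Qed.

Lemma dist_comp0' (X Y Z : C) (f : mor X Y) (g : mor Y Z) (h : mor Z (tsh C X)) :
  dist f g h -> h ∘ g = 0.
Proof. by move/dist_rot/dist_comp0. Qed.

End TriTheory.

Section PureFunctors.
Variables (C : tricat) (w : weight_structure C).

Lemma wc_dd (M : C) (S : weight_complex w M) n :
  wc_d S (n - 1) ∘ wc_d S n = 0.
Proof.
apply: (@shift_inj C n (sval (wc_term S n)) (sval (wc_term S (n - 1 - 1)))).
rewrite (fmapM (shift C n)) fmap0 (wc_dE S n) /=.
rewrite !mcompA shift_succ_natural (wc_dE S (n - 1)).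
rewrite -!mcompA (mcompA (fmap _ _)) -fmapM -!mcompA (dist_comp0' (wc_dist S (n-1))).
by rewrite !compm0 fmap0 comp0m compm0.
Qed.

Lemma wm_chain (M N : C) (S : weight_complex w M) (T : weight_complex w N)
    (f : mor M N) (F : weight_complex_map S T f) n :
  wc_d T n ∘ wm_term F n = wm_term F (n - 1) ∘ wc_d S n.
Proof.
apply: (@shift_inj C n (sval (wc_term S n)) (sval (wc_term T (n - 1)))).
rewrite !(fmapM (shift C n)) (wc_dE S n) (wc_dE T n) /=.
rewrite !mcompA shift_succ_natural -!mcompA wm_q; congr (_ ∘ _).
by rewrite !mcompA -!fmapM wm_p.
Qed.

Section Covariant.
Variables (AA : abelian) (A : add_functor (heart w) AA).

Lemma fmap_wc_dd (M : C) (S : weight_complex w M) n :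
  fmap A (wc_d S (n - 1)) ∘ fmap A (wc_d S n) = 0.
Proof. by rewrite -fmapM wc_dd fmap0. Qed.

Lemma fmap_wm_chain (M N : C) (S : weight_complex w M) (T : weight_complex w N)
    (f : mor M N) (F : weight_complex_map S T f) n :
  fmap A (wm_term F (n - 1)) ∘ fmap A (wc_d S n)
  = fmap A (wc_d T n) ∘ fmap A (wm_term F n).
Proof. by rewrite -!fmapM wm_chain. Qed.

Variable t : weight_complex_choice w.

(* H^A(M): with weight indices, A(M^{-1}) -> A(M^0) -> A(M^1) is formed by the
   terms of index 1, 1 - 1 and 1 - 1 - 1. *)
Definition pure_hom (M : C) : AA := homology (fmap_wc_dd (wcc_obj t M) 1).

Definition pure_hom_map (M N : C) (g : mor M N) :
    mor (pure_hom M) (pure_hom N) :=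
  @homology_map AA _ _ _ _ _ _ _ _ (fmap_wc_dd (wcc_obj t M) 1)
    _ _ (fmap_wc_dd (wcc_obj t N) 1) _ _ _
    (fmap_wm_chain (wcc_map t g) 1) (fmap_wm_chain (wcc_map t g) (1 - 1)).
End Covariant.

Section Contravariant.
Variables (AA : abelian) (A : add_functor (opcat (heart w)) AA).

Definition cofmap (X Y : heart w) (f : mor X Y) : mor (A Y) (A X) :=
  @fmap (opcat (heart w)) AA A Y X f.

Lemma cofmap_wc_dd (M : C) (S : weight_complex w M) n :
  cofmap (wc_d S n) ∘ cofmap (wc_d S (n - 1)) = 0.
Proof.
rewrite /cofmap -(fmapM A).
by rewrite [X in fmap A X](wc_dd S n) fmap0.
Qed.

Lemma cofmap_wm_chain (M N : C) (S : weight_complex w M)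
    (T : weight_complex w N) (f : mor M N) (F : weight_complex_map S T f) n :
  cofmap (wm_term F n) ∘ cofmap (wc_d T n)
  = cofmap (wc_d S n) ∘ cofmap (wm_term F (n - 1)).
Proof.
rewrite /cofmap -!(fmapM A); congr (fmap A _); exact: wm_chain.
Qed.

Variable t : weight_complex_choice w.

(* H_A(M): the homology of A(M^1) -> A(M^0) -> A(M^{-1}), which have weight
   indices 1 - 1 - 1, 1 - 1 and 1. *)
Definition pure_cohom (M : C) : AA :=
  homology (cofmap_wc_dd (wcc_obj t M) 1).

Definition pure_cohom_map (M N : C) (g : mor M N) :
    mor (pure_cohom N) (pure_cohom M) :=
  @homology_map AA _ _ _ _ _ _ _ _ (cofmap_wc_dd (wcc_obj t N) 1)
    _ _ (cofmap_wc_dd (wcc_obj t M) 1) _ _ _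
    (cofmap_wm_chain (wcc_map t g) (1 - 1)) (cofmap_wm_chain (wcc_map t g) 1).
End Contravariant.

(* The coproducts are those of the category [heart w], not of C; small means
   indexed by a type. *)
Definition coproducts_to_products (A : add_functor (opcat (heart w)) Ab) : Prop :=
  forall (I : Type) (X : I -> heart w) (P : heart w)
    (i : forall k, mor (X k) P),
    is_coproduct i ->
    @is_product Ab I (fun k => A (X k)) (A P) (fun k => cofmap A (i k)).

End PureFunctors.

Section Iso.
Variable D : precat.

Lemma iso_id (X : D) : is_iso (idm X).
Proof. by exists (idm X); rewrite comp1m. Qed.

Lemma iso_comp (X Y Z : D) (g : mor Y Z) (f : mor X Y) :
  is_iso g -> is_iso f -> is_iso (g ∘ f).
Proof.
move=> [g' [g'g gg']] [f' [f'f ff']]; exists (f' ∘ g'); split.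
  by rewrite -mcompA (mcompA g') g'g comp1m.
by rewrite -mcompA (mcompA f) ff' comp1m.
Qed.

Lemma iso_fmap (E : precat) (F : add_functor D E) (X Y : D) (f : mor X Y) :
  is_iso f -> is_iso (fmap F f).
Proof. by move=> [g [gf fg]]; exists (fmap F g); rewrite -!fmapM gf fg !fmap1. Qed.

Lemma isomorphic_refl (X : D) : isomorphic X X.
Proof. by exists (idm X); exact: iso_id. Qed.

Lemma isomorphic_sym (X Y : D) : isomorphic X Y -> isomorphic Y X.
Proof. by move=> [f [g [gf fg]]]; exists g, f. Qed.

Lemma isomorphic_trans (Y X Z : D) :
  isomorphic X Y -> isomorphic Y Z -> isomorphic X Z.
Proof. by move=> [f fI] [g gI]; exists (g ∘ f); exact: iso_comp. Qed.

Lemma isomorphic_fmap (E : precat) (F : add_functor D E) (X Y : D) :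
  isomorphic X Y -> isomorphic (F X) (F Y).
Proof. by move=> [f fI]; exists (fmap F f); exact: iso_fmap. Qed.

Lemma isomorphic_retract (X Y : D) : isomorphic X Y -> retract_of X Y.
Proof. by move=> [f [g [gf _]]]; exists f, g. Qed.

Lemma retract_trans (Y X Z : D) :
  retract_of X Y -> retract_of Y Z -> retract_of X Z.
Proof.
move=> [i [p e]] [i' [p' e']]; exists (i' ∘ i), (p ∘ p').
by rewrite -mcompA (mcompA p') e' comp1m.
Qed.
Lemma retract_fmap (E : precat) (F : add_functor D E) (X Y : D) :
  retract_of X Y -> retract_of (F X) (F Y).
Proof. by move=> [i [p e]]; exists (fmap F i), (fmap F p); rewrite -fmapM e fmap1. Qed.
End Iso.

Section ShiftTheory.
Variable C : tricat.
Implicit Types X Y Z T : C.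

Lemma tsh_full X Y (h : mor (tsh C X) (tsh C Y)) : exists f, fmap (tsh C) f = h.
Proof.
have [v [vu uv]] := nt_iso (tunit C) Y.
exists (v ∘ fmap (tshV C) h ∘ tunit C X); apply: tshV_inj.
have /= := nt_natural (tunit C) (v ∘ fmap (tshV C) h ∘ tunit C X).
rewrite !mcompA uv comp1m => /esym.
exact: (is_iso_epiR (nt_iso (tunit C) X)).
Qed.

Lemma tshV_full X Y (h : mor (tshV C X) (tshV C Y)) :
  exists f, fmap (tshV C) f = h.
Proof.
have [v [vu uv]] := nt_iso (tcounit C) X.
exists (tcounit C Y ∘ fmap (tsh C) h ∘ v); apply: tsh_inj.
have /= := nt_natural (tcounit C) (tcounit C Y ∘ fmap (tsh C) h ∘ v).
rewrite -!mcompA vu compm1.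
exact: (is_iso_monoL (nt_iso (tcounit C) Y)).
Qed.

Lemma shift_full n X Y (h : mor (shift C n X) (shift C n Y)) :
  exists f, fmap (shift C n) f = h.
Proof.
have V k : forall h : mor (shift C (Negz k) X) (shift C (Negz k) Y),
    exists f, fmap (shift C (Negz k)) f = h.
  elim: k => [|k IH] h' /=; first exact: tshV_full.
  by have [f' <-] := tshV_full h'; have [f <-] := IH f'; exists f.
case: n h => k h; last exact: V.
elim: k h => [|k IH] h /=; first by exists h.
by have [f' <-] := tsh_full h; have [f <-] := IH f'; exists f.
Qed.

Lemma shift_tsh n X : isomorphic (shift C n (tsh C X)) (shift C (n + 1) X).
Proof.
have [m ->] : exists m, n = int_pred m by exists (n + 1); rewrite -int_predE addrK.
rewrite -int_predE subrK int_predE; case: m => [[|k]|k] /=.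
- by apply: isomorphic_sym; exists (tunit C X); exact: (nt_iso (tunit C) X).
- elim: k => [|k IH] /=; first exact: isomorphic_refl.
  exact: isomorphic_fmap IH.
- elim: k => [|k IH] /=; apply: isomorphic_fmap => //.
  by apply: isomorphic_sym; exists (tunit C X); exact: (nt_iso (tunit C) X).
Qed.

Lemma tsh_shift n X : isomorphic (tsh C (shift C n X)) (shift C (n + 1) X).
Proof.
have [m ->] : exists m, n = int_pred m by exists (n + 1); rewrite -int_predE addrK.
rewrite -int_predE subrK int_predE; case: m => [[|k]|k] /=.
- by exists (tcounit C X); exact: (nt_iso (tcounit C) X).
- exact: isomorphic_refl.
- by exists (tcounit C (shift C (Negz k) X)); exact: (nt_iso (tcounit C) _).
Qed.

Lemma shift_isomorphic n X Y : isomorphic (shift C n X) (shift C n Y) ->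
  isomorphic X Y.
Proof.
move=> [f [g [gf fg]]]; have [f' E] := shift_full f; have [g' E'] := shift_full g.
by exists f', g'; split; apply: (@shift_inj _ n); rewrite fmapM fmap1 E E'.
Qed.

Lemma shift_add m n X : isomorphic (shift C n (shift C m X)) (shift C (n + m) X).
Proof.
have S k l : (forall Y, isomorphic (shift C l (shift C k Y)) (shift C (l + k) Y)) <->
   (forall Y, isomorphic (shift C l (shift C (k + 1) Y)) (shift C (l + (k + 1)) Y)).
  have E Y : isomorphic (shift C l (shift C (k + 1) Y))
                        (shift C l (shift C k (tsh C Y))).
    exact/isomorphic_fmap/isomorphic_sym/shift_tsh.
  split=> H Y.
    apply: isomorphic_trans (E Y) _; apply: isomorphic_trans (H _) _.
    by rewrite addrA; apply: shift_tsh.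
  have c : isomorphic (tsh C (tshV C Y)) Y by exists (tcounit C Y); exact: (nt_iso (tcounit C) Y).
  have c' := isomorphic_sym c.
  apply: isomorphic_trans (isomorphic_fmap _ (isomorphic_fmap _ c')) _.
  apply: isomorphic_trans (isomorphic_sym (E _)) _.
  apply: isomorphic_trans (H _) _; rewrite addrA.
  apply: isomorphic_trans (isomorphic_sym (shift_tsh _ _)) _.
  exact: isomorphic_fmap.
elim/int_ind: m X => [|m IH|m IH] X; first by rewrite addr0; exact: isomorphic_refl.
  by rewrite -addn1 PoszD; move: X; apply: (S _ _).1.
have -> : - (m.+1)%:Z = - m%:Z - 1 by lia.
by move: X; apply: (S _ _).2; rewrite subrK.
Qed.
End ShiftTheory.

Section Triangles.
Variable C : tricat.
Implicit Types X Y Z T : C.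

Lemma tri_lift X Y Z T (f : mor X Y) (g : mor Y Z) (h : mor Z (tsh C X))
    (u : mor T Y) : dist f g h -> g ∘ u = 0 -> exists v, u = f ∘ v.
Proof.
have [[Z0 Z0P] _] := tadditive C.
move=> /dist_rot D gu; have /dist_rot D0 := dist_id T Z0P.
have [|c [_ E]] := dist_fill (a := u) (b := 0 : mor Z0 Z) D0 D.
  by rewrite gu comp0m.
have [v cE] := tsh_full c; exists v; apply: tsh_inj; apply: oppr_inj.
by rewrite fmapM cE -compNl -E fmap1 compNr compm1.
Qed.

Lemma tri_desc X Y Z T (f : mor X Y) (g : mor Y Z) (h : mor Z (tsh C X))
    (u : mor Y T) : dist f g h -> u ∘ f = 0 -> exists v, u = v ∘ g.
Proof.
have [[Z0 Z0P] _] := tadditive C.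
move=> D uf.
have SZ0 : is_zero (tsh C Z0) by rewrite /is_zero -fmap1 Z0P fmap0.
have D0 : dist (0 : mor Z0 T) (idm T) (0 : mor T (tsh C Z0)).
  by apply/dist_rot; rewrite fmap0 oppr0; exact: dist_id.
have [|c [E _]] := dist_fill (a := 0 : mor X Z0) (b := u) D D0.
  by rewrite uf comp0m.
by exists c; rewrite E comp1m.
Qed.

Lemma tri_endo X Y Z (f : mor X Y) (g : mor Y Z) (h : mor Z (tsh C X))
    (e : mor Z Z) : dist f g h -> e ∘ g = g -> h = h ∘ e -> is_iso e.
Proof.
move=> D eg he.
have xg : (e - idm Z) ∘ g = 0 by rewrite compBl eg comp1m subrr.
have hx : h ∘ (e - idm Z) = 0 by rewrite compBr -he compm1 subrr.
have [y yE] : exists y, e - idm Z = y ∘ h.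
  by move/dist_rot: D => D'; exact: tri_desc D' xg.
have x2 : (e - idm Z) ∘ (e - idm Z) = 0.
  by rewrite [X in X ∘ _]yE -mcompA hx compm0.
move: (e - idm Z) x2 (subrK (idm Z) e) => x x2 <-; exists (idm Z - x).
rewrite compBl compBr !compDl !compDr !compm1 !comp1m x2 add0r.
by rewrite addrC addKr.
Qed.

Lemma dist_fill_iso X Y Z X' Y' Z'
    (f : mor X Y) (g : mor Y Z) (h : mor Z (tsh C X))
    (f' : mor X' Y') (g' : mor Y' Z') (h' : mor Z' (tsh C X'))
    (a : mor X X') (b : mor Y Y') :
  dist f g h -> dist f' g' h' -> b ∘ f = f' ∘ a -> is_iso a -> is_iso b ->
  exists c : mor Z Z', [/\ c ∘ g = g' ∘ b, fmap (tsh C) a ∘ h = h' ∘ c & is_iso c].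
Proof.
move=> D D' E [a' [a'a aa']] [b' [b'b bb']].
have [c [c1 c2]] := dist_fill D D' E.
have [|d [d1 d2]] := dist_fill (a := a') (b := b') D' D.
  rewrite -[LHS]compm1 -aa' -!mcompA (mcompA f') -E !mcompA b'b comp1m.
  by [].
have dcI : is_iso (d ∘ c).
  apply: (tri_endo D); first by rewrite -mcompA c1 mcompA d1 -mcompA b'b compm1.
  by rewrite mcompA -d2 -mcompA -c2 mcompA -fmapM a'a fmap1 comp1m.
have cdI : is_iso (c ∘ d).
  apply: (tri_endo D'); first by rewrite -mcompA d1 mcompA c1 -mcompA bb' compm1.
  by rewrite mcompA -c2 -mcompA -d2 mcompA -fmapM aa' fmap1 comp1m.
exists c; split=> //.
move: dcI cdI => [u [u1 u2]] [v [v1 v2]]; exists (u ∘ d); split.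
  by rewrite -mcompA.
have -> : u ∘ d = d ∘ v; last by rewrite mcompA.
transitivity (u ∘ (d ∘ c) ∘ (d ∘ v)); last by rewrite u1 comp1m.
by rewrite -[LHS]compm1 -v2 !mcompA.
Qed.

Lemma tsh_dist X Y Z (f : mor X Y) (g : mor Y Z) (h : mor Z (tsh C X)) :
  dist f g h -> exists h', dist (fmap (tsh C) f) (fmap (tsh C) g) h'.
Proof.
move=> /dist_rot/dist_rot/dist_rot D; exists (- fmap (tsh C) h).
have NI (W : C) : is_iso (- idm W).
  by exists (- idm W); rewrite compNl compNr opprK comp1m.
apply: (dist_iso (a := idm _) (b := - idm _) (c := idm _)) D;
  try exact: iso_id; try exact: NI.
- by rewrite compNl compNr opprK comp1m compm1.
- by rewrite !compNr comp1m compm1.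
- by rewrite fmap1 compm1 comp1m.
Qed.

Lemma tshV_dist X Y Z (f : mor X Y) (g : mor Y Z) (h : mor Z (tsh C X)) :
  dist f g h -> exists h', dist (fmap (tshV C) f) (fmap (tshV C) g) h'.
Proof.
move=> D; have [W [g1 [h1 D1]]] := dist_cone (fmap (tshV C) f).
have [h2 D2] := tsh_dist D1.
have eI U := nt_iso (tcounit C) U; have uI U := nt_iso (tunit C) U.
have [c [c1 _ cI]] := dist_fill_iso D2 D (nt_natural (tcounit C) f) (eI X) (eI Y).
pose a U := fmap (tshV C) (tcounit C U) ∘ tunit C (tshV C U).
have aI U : is_iso (a U) by apply: iso_comp => //; exact: iso_fmap.
pose e := fmap (tshV C) c ∘ tunit C W.
have eeI : is_iso e by apply: iso_comp => //; exact: iso_fmap.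
have [e' [e'e ee']] := eeI.
exists (fmap (tsh C) (a X) ∘ h1 ∘ e').
apply: (dist_iso (aI X) (aI Y) eeI) D1.
- rewrite /a -mcompA (nt_natural (tunit C)) /= !mcompA -!fmapM.
  by rewrite (nt_natural (tcounit C)).
- by rewrite /e /a -mcompA (nt_natural (tunit C)) /= !mcompA -!fmapM c1.
- by rewrite -mcompA e'e compm1.
Qed.

Lemma shift_dist n X Y Z (f : mor X Y) (g : mor Y Z) (h : mor Z (tsh C X)) :
  dist f g h -> exists h', dist (fmap (shift C n) f) (fmap (shift C n) g) h'.
Proof.
case: n => k D /=.
  by elim: k => [|k [h' IH]] /=; [exists h | exact: tsh_dist IH].
suff [h' D'] : exists h', dist (fmap (shift C (- k%:Z)) f)
    (fmap (shift C (- k%:Z)) g) h'.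
  by case: k h' D' => [|k] h' D'; exact: tshV_dist D'.
elim: k => [|k [h' IH]]; first by exists h.
by case: k h' IH => [|k] h' IH; exact: tshV_dist IH.
Qed.
End Triangles.

Section WeightTheory.
Variables (C : tricat) (w : weight_structure C).
Implicit Types X Y Z M N : C.

Lemma shift_class_iso (P : C -> Prop) n X Y :
  isomorphic X Y -> shift_class P n Y -> shift_class P n X.
Proof. by move=> E [Z [PZ YZ]]; exists Z; split=> //; exact: isomorphic_trans YZ. Qed.

Lemma shift_class_shift (P : C -> Prop) n m X :
  shift_class P n X -> shift_class P (m + n) (shift C m X).
Proof.
move=> [Z [PZ XZ]]; exists Z; split=> //.
apply: isomorphic_trans (isomorphic_fmap (shift C m) XZ) _; exact: shift_add.
Qed.

Lemma shift_class_tsh (P : C -> Prop) n X :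
  shift_class P n X -> shift_class P (n + 1) (tsh C X).
Proof.
move=> [Z [PZ XZ]]; exists Z; split=> //.
apply: isomorphic_trans (isomorphic_fmap (tsh C) XZ) _; exact: tsh_shift.
Qed.

Lemma w_orthn n X Y (f : mor X Y) : w_le w n X -> w_ge w (n + 1) Y -> f = 0.
Proof.
move=> [X0 [X0P [a [a' [a1 a2]]]]] [Y0 [Y0P Y0E]].
have [b [b' [b1 b2]]] : isomorphic Y (shift C n (tsh C Y0)).
  exact: isomorphic_trans Y0E (isomorphic_sym (shift_tsh _ _)).
have [g gE] := shift_full (b ∘ f ∘ a').
have g0 : g = 0.
  apply: (w_orth g X0P); exists Y0; split=> //; exact: isomorphic_refl.
rewrite -(comp1m f) -b1 -(compm1 (_ ∘ f)) -a1 mcompA -(mcompA b') -(mcompA b').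
by rewrite -gE g0 fmap0 compm0 comp0m.
Qed.

Lemma w_ge_pred n X : w_ge w (n + 1) X -> w_ge w n X.
Proof.
move=> [Z [PZ XZ]]; exists (tsh C Z); split.
  by apply: w_ge0_shift; exists Z; split=> //; exact: isomorphic_refl.
by apply: isomorphic_trans XZ _; apply: isomorphic_sym; exact: shift_tsh.
Qed.

Lemma w_le_succ n X : w_le w n X -> w_le w (n + 1) X.
Proof.
move=> [Z [/w_le0_shift[Z' [PZ' ZZ']] XZ]]; exists Z'; split=> //.
apply: isomorphic_trans XZ _; apply: isomorphic_trans (isomorphic_fmap _ ZZ') _.
exact: shift_tsh.
Qed.

Lemma shift_class_retract (P : C -> Prop) n X Y :
  (forall X Y, retract_of X Y -> P Y -> P X) ->
  retract_of X Y -> shift_class P n Y -> shift_class P n X.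
Proof.
move=> Pr XY [Z [PZ YZ]]; exists (shift C (- n) X).
have E W : isomorphic W (shift C n (shift C (- n) W)).
  by apply: isomorphic_sym; have := shift_add (- n) n W; rewrite subrr.
split; last exact: E.
apply: Pr PZ; apply: (retract_trans (retract_fmap _ XY)).
apply: isomorphic_retract; apply: isomorphic_trans (isomorphic_fmap _ YZ) _.
by have := shift_add n (- n) Z; rewrite addNr.
Qed.

Lemma weight_decomp_exists n M : exists (L R : C)
  (a : mor L M) (b : mor M R) (c : mor R (tsh C L)), is_weight_decomp w n a b c.
Proof.
have [L [R [a [b [c [D LP RP]]]]]] := w_decomp w (shift C (- n) M).
have [c' D'] := shift_dist n D.
have [e eI] : isomorphic (shift C n (shift C (- n) M)) M.
  by have := shift_add (- n) n M; rewrite subrr.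
have [e' [e'e ee']] := eI.
exists (shift C n L), (shift C n R), (e ∘ fmap (shift C n) a),
  (fmap (shift C n) b ∘ e'), c'; split.
- apply: (dist_iso (iso_id _) eI (iso_id _)) D'.
  + by rewrite compm1.
  + by rewrite comp1m -mcompA e'e compm1.
  + by rewrite fmap1 comp1m compm1.
- by exists L; split=> //; exact: isomorphic_refl.
- exact: shift_class_shift.
Qed.

Lemma w_le_orth n X : (forall Y (f : mor X Y), w_ge w (n + 1) Y -> f = 0) ->
  w_le w n X.
Proof.
move=> X0; have [L [R [a [b [c [D LP RP]]]]]] := weight_decomp_exists n X.
have [|v E] := tri_lift (u := idm X) D; first by rewrite compm1; exact: X0.
apply: (shift_class_retract (@w_le0_retract _ w) _ LP).
by exists v, a.
Qed.

Lemma w_ge_orth n X : (forall Y (f : mor Y X), w_le w n Y -> f = 0) ->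
  w_ge w (n + 1) X.
Proof.
move=> X0; have [L [R [a [b [c [D LP RP]]]]]] := weight_decomp_exists n X.
have [|v E] := tri_desc (u := idm X) D; first by rewrite comp1m; exact: X0.
apply: (shift_class_retract (@w_ge0_retract _ w) _ RP).
by exists b, v.
Qed.

Section Terms.
Variables (n : int) (M W W' R R' Q : C).
Variables (a' : mor W' M) (b' : mor M R') (c' : mor R' (tsh C W')).
Variables (a : mor W M) (b : mor M R) (c : mor R (tsh C W)).
Hypotheses (D' : is_weight_decomp w (n - 1) a' b' c').
Hypotheses (D : is_weight_decomp w n a b c).
Variables (g : mor W' W) (gE : a ∘ g = a').
Variables (p : mor W Q) (q : mor Q (tsh C W')) (DQ : dist g p q).

Lemma cone_w_le : w_le w n Q.
Proof.
apply: w_le_orth => Y f YP; case: D D' => _ WP _ [_ W'P _].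
have [|v E] := tri_desc (u := f) ((dist_rot _ _ _).1 DQ).
  exact: (w_orthn _ WP YP).
rewrite E (w_orthn v _ YP) ?comp0m //.
by rewrite -[n](subrK 1); exact: shift_class_tsh.
Qed.

Lemma cone_w_ge : w_ge w n Q.
Proof.
rewrite -[n](subrK 1); apply: w_ge_orth => Y f YP.
case: D D' => T WP RP [T' W'P R'P]; rewrite -gE in T'.
have [f1 [g1 [T1 _ _ _ _]]] := dist_octahedron DQ T T'.
have f1f : f1 ∘ f = 0 by exact: (w_orthn _ YP R'P).
have /dist_rot T2 := T1.
have [|v E] := tri_lift (u := fmap (tsh C) f) ((dist_rot _ _ _).1 T2).
  by rewrite compNl -fmapM f1f fmap0 oppr0.
apply: tsh_inj; rewrite E fmap0 (w_orthn v _ RP) ?compm0 //.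
by rewrite -[n](subrK 1); exact: shift_class_tsh.
Qed.

Lemma cone_heart : w_eq w 0 (shift C (- n) Q).
Proof.
by rewrite -(addNr n); split; apply: shift_class_shift;
  [exact: cone_w_ge | exact: cone_w_le].
Qed.
End Terms.

Lemma weight_complex_exists M : inhabited (weight_complex w M).
Proof.
have tr n : {W : C & {a : mor W M | exists (R : C) (b : mor M R)
    (c : mor R (tsh C W)), is_weight_decomp w n a b c}}.
  have /cid[W /cid[R /cid[a abc]]] := weight_decomp_exists n M.
  by exists W, a; exists R.
pose W n := projT1 (tr n); pose a n := sval (projT2 (tr n)).
have aP n : exists (R : C) (b : mor M R) (c : mor R (tsh C (W n))),
    is_weight_decomp w n (a n) b c by exact: svalP (projT2 (tr n)).
have gx n : {g : mor (W (n - 1)) (W n) | a n ∘ g = a (n - 1)}.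
  apply: cid; have [R [b [c [D _ RP]]]] := aP n.
  have [R' [b' [c' [_ WP _]]]] := aP (n - 1).
  have [|v ->] := tri_lift (u := a (n - 1)) D; last by exists v.
  by apply: (w_orthn _ WP); rewrite subrK; exact: w_ge_pred.
pose g n := sval (gx n).
have qx n : {T : heart w & {p : mor (W n) (shift C n (heart_incl w T)) &
    {q : mor (shift C n (heart_incl w T)) (tsh C (W (n - 1))) | dist (g n) p q}}}.
  have /cid[Q /cid[p /cid[q D]]] := dist_cone (g n).
  have QP : w_eq w 0 (shift C (- n) Q).
    have [R [b [c abc]]] := aP n; have [R' [b' [c' abc']]] := aP (n - 1).
    exact: (cone_heart abc' abc (svalP (gx n)) D).
  have /cid[e eI] : isomorphic Q (shift C n (shift C (- n) Q)).
    by apply: isomorphic_sym; have := shift_add (- n) n Q; rewrite subrr.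
  have /cid[e' [e'e ee']] := eI.
  exists (exist _ _ QP), (e ∘ p), (q ∘ e').
  apply: (dist_iso (iso_id _) (iso_id _) eI) D.
  - by rewrite compm1 comp1m.
  - by rewrite compm1.
  - by rewrite fmap1 comp1m -mcompA e'e compm1.
pose T n := projT1 (qx n); pose p n := projT1 (projT2 (qx n)).
pose q n := sval (projT2 (projT2 (qx n))).
have dx n : {d : mor (T n) (T (n - 1)) |
    fmap (shift C n) (fmap (heart_incl w) d) =
    shift_succ n (heart_incl w (T (n - 1)))
      ∘ fmap (tsh C) (p (n - 1)) ∘ q n}.
  by apply: cid; exact: shift_full.
exact: inhabits (@WeightComplex C w M W a aP g (fun n => svalP (gx n)) T p q
  (fun n => svalP (projT2 (projT2 (qx n)))) (fun n => sval (dx n))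
  (fun n => svalP (dx n))).
Qed.

Lemma weight_complex_map_exists M N (S : weight_complex w M)
    (T : weight_complex w N) (f : mor M N) : inhabited (weight_complex_map S T f).
Proof.
have fx n : {f' : mor (wc_trunc S n) (wc_trunc T n) |
    wc_arr T n ∘ f' = f ∘ wc_arr S n}.
  apply: cid; have [R [b [c [D _ RP]]]] := wc_arrP T n.
  have [R' [b' [c' [_ WP _]]]] := wc_arrP S n.
  have [|v ->] := tri_lift (u := f ∘ wc_arr S n) D; last by exists v.
  exact: (w_orthn _ WP).
pose f' n := sval (fx n).
have fg n : f' n ∘ wc_g S n = wc_g T n ∘ f' (n - 1).
  apply/eqP; rewrite -subr_eq0; apply/eqP; apply: tsh_inj; rewrite fmap0.
  have [R [b [c [D _ RP]]]] := wc_arrP T n.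
  have [R' [b' [c' [_ WP _]]]] := wc_arrP S (n - 1).
  move/dist_rot/dist_rot: D => D.
  have [|v ->] := tri_lift
      (u := fmap (tsh C) (f' n ∘ wc_g S n - wc_g T n ∘ f' (n - 1))) D.
    rewrite compNl -fmapM compBr !mcompA (svalP (fx n)) -mcompA !wc_gE.
    by rewrite (svalP (fx (n - 1))) subrr fmap0 oppr0.
  rewrite (w_orthn v _ RP) ?compm0 //.
  by have := shift_class_tsh WP; rewrite subrK.
have hx n : {h : mor (wc_term S n) (wc_term T n) |
    fmap (shift C n) (fmap (heart_incl w) h) ∘ wc_p S n = wc_p T n ∘ f' n /\
    wc_q T n ∘ fmap (shift C n) (fmap (heart_incl w) h)
    = fmap (tsh C) (f' (n - 1)) ∘ wc_q S n}.
  apply: cid.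
  have [c [c1 c2]] := dist_fill (wc_dist S n) (wc_dist T n) (fg n).
  have [h hE] := @shift_full C n (sval (wc_term S n)) (sval (wc_term T n)) c.
  exists h; rewrite /= hE; split; first exact: c1.
  exact: esym c2.
exact: inhabits (@WeightComplexMap C w M N S T f f' (fun n => svalP (fx n))
  (fun n => sval (hx n)) (fun n => (svalP (hx n)).1) (fun n => (svalP (hx n)).2)).
Qed.

(* So quantifying over all [weight_complex_choice w] is never vacuous. *)
Lemma weight_complex_choice_exists : inhabited (weight_complex_choice w).
Proof.
have ex M : {S : weight_complex w M | True}.
  by apply: cid; have [S] := weight_complex_exists M; exists S.
pose S M := sval (ex M).
have mx M N (f : mor M N) : {F : weight_complex_map (S M) (S N) f | True}.
  by apply: cid; have [F] := weight_complex_map_exists (S M) (S N) f; exists F.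
exact: inhabits (@WeightComplexChoice C w S (fun M N f => sval (mx M N f))).
Qed.
End WeightTheory.

(* Main.v *)
Require Import Defs.
From mathcomp Require Import all_boot all_order all_algebra.
From mathcomp Require Import boolp.
Import GRing.Theory.
Local Open Scope ring_scope.
Local Open Scope cat_scope.

(** Shifting by [-j] reduces everything to weight 0. Write W_n for w_{<=n}M,
    M_n for the term of weight n of t(M), and V_n, N_n for the same data of N.
    Killing weight 0 means that the composite W_0 -> M -> N lifts to V_{-1}.

    Such a lift u : W_0 -> V_{-1} makes the map f_0 : W_0 -> V_0 over g differ
    from the image of u by something that vanishes in N. By orthogonality a
    morphism from an object of weights <= 0 to V_0 that vanishes in N already
    vanishes in V_1, so it factors through the boundary N_1 -> V_0 of the
    triangle V_0 -> V_1 -> N_1[1]. Orthogonality again extends this factor from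
    W_0 to M_0 and the remaining error from W_{-1}[1] to M_{-1}; the outcome is
    that the component M_0 -> N_0 of t(g) has the form d x + y d
    ([kills_weight0_null]). Every additive functor carries this to a map that
    is zero on homology at that place, hence all pure functors vanish on g.

    Conversely two representable functors suffice to detect the lift. Applying
    C(W_0, -) to the cycle W_0 -> M_0 provides an x : W_0 -> N_1 by which f_0
    may be corrected so that it lifts to V_{-1} ([kills_weight0_of_cycle]).
    Applying C(-, Y), for Y = w_{>=0}N, to the cocycle N_0 -> Y induced by
    V_0 -> N -> Y shows that W_0 -> M -> N -> Y is zero
    ([kills_weight0_of_cocycle]). The latter functor respects products: on the
    heart, an object Y of weights >= 0 has a two-term resolution by objects of
    the heart ([heart_cover]), so C(-, Y) is there the cokernel of a morphism of
    representable functors, and products of abelian groups are exact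
    ([hom_to_coproducts]). *)

Set Implicit Arguments.
Unset Strict Implicit.
Unset Printing Implicit Defensive.

(** * Maps that vanish on homology *)

Section HomologyMap.
Variables (A : abelian) (X Y Z X' Y' Z' : A).
Variables (f : mor X Y) (g : mor Y Z) (e : g ∘ f = 0).
Variables (f' : mor X' Y') (g' : mor Y' Z') (e' : g' ∘ f' = 0).
Variables (a : mor X X') (b : mor Y Y') (c : mor Z Z').
Variables (ef : b ∘ f = f' ∘ a) (eg : c ∘ g = g' ∘ b).

Lemma cokerm_epi (U V : A) (h : mor U V) : is_epi (cokerm h).
Proof.
move=> T u1 u2 E; have z : u2 ∘ cokerm h ∘ h = 0.
  by rewrite -mcompA (cokermP h).1 compm0.
by case: ((cokermP h).2 T _ z) => u [_ Uq]; rewrite -(Uq _ E) -(Uq u2 erefl).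
Qed.

(** On cycles the second summand disappears and the first one is a boundary. *)
Lemma homology_map_null (s : mor Y X') (r : mor Z Y') :
  b = f' ∘ s + r ∘ g -> homology_map e e' ef eg = 0.
Proof.
move=> bE; apply: (cokerm_epi (h := ker_lift e)); rewrite comp0m coker_descE.
have -> : cycles_map eg = ker_lift e' ∘ (s ∘ kerm g).
  apply: kerm_mono; rewrite ker_liftE mcompA ker_liftE bE compDl -!mcompA.
  by rewrite (kermP g).1 compm0 addr0.
by rewrite mcompA (cokermP _).1 comp0m.
Qed.
End HomologyMap.

Section AbHomologyMap.
Variables (X Y Z X' Y' Z' : Ab).
Variables (f : mor X Y) (g : mor Y Z) (e : g ∘ f = 0).
Variables (f' : mor X' Y') (g' : mor Y' Z') (e' : g' ∘ f' = 0).
Variables (a : mor X X') (b : mor Y Y') (c : mor Z Z').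
Variables (ef : b ∘ f = f' ∘ a) (eg : c ∘ g = g' ∘ b).

(** The kernels and cokernels that enter [homology] are known only by their
    universal properties; comparing them with the concrete ones of abelian
    groups gives access to elements. *)
Lemma homology_map_eq0_Ab (x : Y) : homology_map e e' ef eg = 0 ->
  (g : {additive _ -> _}) x = 0 ->
  exists y, (f' : {additive _ -> _}) y = (b : {additive _ -> _}) x.
Proof.
move=> H0 gx.
have k : x \in ab_kerp g by rewrite ab_kerpE gx.
pose i := @ker_lift Ab Y Z g _ _ (ab_ker_is_kernel g).1.
pose z := cycles_map eg ∘ i.
have z0 : ab_pi (ker_lift e') ((z : {additive _ -> _}) (AbKer k)) = 0.
  have [u [uE _]] :=
    (cokermP (ker_lift e')).2 _ _ (ab_coker_is_cokernel (ker_lift e')).1.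
  have : (ab_pi (ker_lift e') : mor (_ : Ab) _) ∘ z = 0.
    rewrite -uE /z -!mcompA [X in u ∘ X]mcompA.
    rewrite -(coker_descE (homology_map_subproof e e' ef eg)).
    by rewrite -/(homology_map _ _ _ _) H0 !comp0m compm0.
  by move/(congr1 (fun h : {additive _ -> _} => h (AbKer k))).
have [y yE] := (ab_pi_eq0 _ _).1 z0; exists y.
have := congr1 (fun h : {additive _ -> _} => h y) (ker_liftE e').
move=> /= <-; rewrite yE.
have : kerm g' ∘ z = b ∘ (val : {additive ab_ker g -> Y}).
  by rewrite mcompA ker_liftE -mcompA ker_liftE.
by move/(congr1 (fun h : {additive _ -> _} => h (AbKer k))).
Qed.
End AbHomologyMap.

(** * Representable functors on the heart *)

Section Hom.
Variables (C : tricat) (w : weight_structure C).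

Section Contravariant.
Variable Y : C.
Definition precomp (X X' : C) (f : mor X X') (u : mor X' Y) : mor X Y := u ∘ f.
Fact precomp_additive X X' (f : mor X X') : zmod_morphism (precomp f).
Proof. by move=> u v; exact: compBl. Qed.

Program Definition hom_to : add_functor (opcat (heart w)) Ab :=
  @AddFunctor (opcat (heart w)) Ab (fun X => mor (sval X) Y)
    (fun X X' f => mk_additive (@precomp_additive (sval X') (sval X) f)) _ _ _.
Next Obligation. by apply: additive_eq => u; exact: compm1. Qed.
Next Obligation. by apply: additive_eq => u; exact: mcompA. Qed.
Next Obligation. by apply: additive_eq => u; exact: compDr. Qed.
End Contravariant.

Section Covariant.
Variable X : C.
Definition postcomp (Y Y' : C) (f : mor Y Y') (u : mor X Y) : mor X Y' := f ∘ u.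
Fact postcomp_additive Y Y' (f : mor Y Y') : zmod_morphism (postcomp f).
Proof. by move=> u v; exact: compBr. Qed.

Program Definition hom_from : add_functor (heart w) Ab :=
  @AddFunctor (heart w) Ab (fun Y => mor X (sval Y))
    (fun Y Y' f => mk_additive (@postcomp_additive (sval Y) (sval Y') f)) _ _ _.
Next Obligation. by apply: additive_eq => u; exact: comp1m. Qed.
Next Obligation. by apply: additive_eq => u; exact/esym/mcompA. Qed.
Next Obligation. by apply: additive_eq => u; exact: compDl. Qed.
End Covariant.
End Hom.

Section Weights.
Variables (C : tricat) (w : weight_structure C).
Local Notation ι := (fmap (heart_incl w)).

(** * Weight decompositions and killing a weight *)

Lemma weight_decomp_shift m n (M L R : C) (a : mor L M) (b : mor M R)
    (c : mor R (tsh C L)) : is_weight_decomp w m a b c ->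
  exists c',
    is_weight_decomp w (n + m) (fmap (shift C n) a) (fmap (shift C n) b) c'.
Proof.
move=> [D LP RP]; have [c' D'] := shift_dist n D.
exists c'; split=> //; first exact: shift_class_shift.
by rewrite -addrA; exact: shift_class_shift.
Qed.

(** By orthogonality, L -> M factors through the left part of any other
    j-weight decomposition of M, and N -> R' through the right part of any other
    (j-1)-weight decomposition of N. *)
Lemma kills_weight_any j (M N : C) (g : mor M N) (L R L' R' : C)
    (a : mor L M) (b : mor M R) (c : mor R (tsh C L))
    (a' : mor L' N) (b' : mor N R') (c' : mor R' (tsh C L')) :
  kills_weight w j g ->
  is_weight_decomp w j a b c -> is_weight_decomp w (j - 1) a' b' c' ->
  b' ∘ g ∘ a = 0.
Proof.
move=> [L1 [R1 [L1' [R1' [a1 [b1 [c1 [a1' [b1' [c1' [D1 D1' E]]]]]]]]]]].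
move=> [_ LP _] [_ _ RP'].
have [D1t _ R1P] := D1; have [D1't L1'P _] := D1'.
have [|v ->] := tri_lift (u := a) D1t; first exact: (w_orthn _ LP R1P).
have [|v' ->] := tri_desc (u := b') D1't; first exact: (w_orthn _ L1'P RP').
by rewrite !mcompA -(mcompA v') -(mcompA v') E compm0 comp0m.
Qed.

Lemma kills_weight_shift n j (M N : C) (g : mor M N) :
  kills_weight w j g <-> kills_weight w (n + j) (fmap (shift C n) g).
Proof.
split=> [[L [R [L' [R' [a [b [c [a' [b' [c' [D D' E]]]]]]]]]]]|K].
  have [d Dn] := weight_decomp_shift n D.
  have [d' Dn'] := weight_decomp_shift n D'.
  do 4!eexists; exists (fmap (shift C n) a), (fmap (shift C n) b), d.
  exists (fmap (shift C n) a'), (fmap (shift C n) b'), d'.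
  by split=> //; [rewrite -addrA | rewrite -!fmapM E fmap0].
(* The decompositions witnessing [K] need not be shifts; those of M and N are
   shifted instead, which is harmless by independence of the choice. *)
have [L [R [a [b [c D]]]]] := weight_decomp_exists w j M.
have [L' [R' [a' [b' [c' D']]]]] := weight_decomp_exists w (j - 1) N.
exists L, R, L', R', a, b, c, a', b', c'; split=> //.
apply: (@shift_inj _ n); rewrite fmap0 !fmapM.
have [d Dn] := weight_decomp_shift n D.
have [d' Dn'] := weight_decomp_shift n D'.
by apply: kills_weight_any K Dn _; rewrite -addrA; exact: Dn'.
Qed.

(** The obstruction lives in C(T[1], w_{>=n+1}M), which vanishes as soon as T
    has weights <= n-1. *)
Lemma weight_decomp_arr_mono n (M L R T : C) (a : mor L M) (b : mor M R)
    (c : mor R (tsh C L)) (z : mor T L) :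
  is_weight_decomp w n a b c -> w_le w (n - 1) T -> a ∘ z = 0 -> z = 0.
Proof.
move=> [/dist_rot/dist_rot D _ RP] TP az; apply: tsh_inj; rewrite fmap0.
have [|v ->] := tri_lift (u := fmap (tsh C) z) D.
  by rewrite compNl -fmapM az fmap0 oppr0.
have := shift_class_tsh TP; rewrite subrK => tT.
by rewrite (w_orthn v tT RP) compm0.
Qed.

Lemma shift_succ_iso n (X : C) : is_iso (shift_succ n X).
Proof.
rewrite /shift_succ; move: (esym (int_predE n)).
move: (n - 1) => m e; case: m / e => /=.
case: n => [[|k]|k] /=; [exact: (nt_iso (tcounit C) X) | exact: iso_id |].
exact: (nt_iso (tcounit C) (shift C (Negz k) X)).
Qed.

Lemma shift_succ1 (X : C) : shift_succ 1 X = idm (tsh C X).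
Proof.
rewrite /shift_succ; move: (esym (int_predE 1)) => e.
by rewrite (eq_irrelevance e erefl).
Qed.

(** * The weight complex around weight 0 *)

(* The weights 1, 0 and -1 are written 1, 1 - 1 and 1 - 1 - 1, as in the
   homology groups that define pure functors; [shift C (1 - 1)] is then the
   identity by computation. *)

Section WeightZero.
Variables (M : C) (S : weight_complex w M).

Lemma wc_term_eq n :
  w_ge w 0 (heart_incl w (wc_term S n)) /\ w_le w 0 (heart_incl w (wc_term S n)).
Proof. exact: svalP (wc_term S n). Qed.

Lemma wc_trunc_le n : w_le w n (wc_trunc S n).
Proof. by have [R [b [c []]]] := wc_arrP S n. Qed.

(** [wc_p0] and [wc_q0] are [wc_p] and [wc_q] in weight 0, retyped without the
    trivial shift. *)
Definition wc_p0 : mor (wc_trunc S (1 - 1)) (heart_incl w (wc_term S (1 - 1))) :=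
  wc_p S (1 - 1).
Definition wc_q0 :
    mor (heart_incl w (wc_term S (1 - 1))) (tsh C (wc_trunc S (1 - 1 - 1))) :=
  wc_q S (1 - 1).

Lemma wc_dist0 : dist (wc_g S (1 - 1)) wc_p0 wc_q0.
Proof. exact: wc_dist S (1 - 1). Qed.

(** [q] is the boundary M_1 -> W_0 of the triangle W_0 -> W_1 -> M_1[1]. A
    morphism from weights <= 0 to W_0 that vanishes in M vanishes in W_1 by
    [weight_decomp_arr_mono], hence comes from M_1. *)
Lemma wc_boundary :
  exists q : mor (heart_incl w (wc_term S 1)) (wc_trunc S (1 - 1)),
  [/\ wc_arr S (1 - 1) ∘ q = 0, ι (wc_d S 1) = wc_p0 ∘ q
    & forall T (z : mor T (wc_trunc S (1 - 1))), w_le w 0 T ->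
      wc_arr S (1 - 1) ∘ z = 0 -> exists y, z = q ∘ y].
Proof.
have [q qE] :=
  @tsh_full C (heart_incl w (wc_term S 1)) (wc_trunc S (1 - 1)) (wc_q S 1).
have D := wc_dist S 1; move/dist_rot/dist_rot in D.
exists q; split.
- rewrite -wc_gE -mcompA; apply: tsh_inj.
  rewrite !fmapM qE fmap0; have := dist_comp0 D; rewrite compNl => /eqP.
  by rewrite oppr_eq0 => /eqP E; rewrite [X in _ ∘ X]E compm0.
- apply: tsh_inj; rewrite fmapM qE.
  by have /= := wc_dE S 1; rewrite shift_succ1 comp1m.
- move=> T z TP z0.
  have gz : wc_g S 1 ∘ z = 0.
    have [R [b [c DM]]] := wc_arrP S 1.
    by apply: (weight_decomp_arr_mono DM TP); rewrite mcompA wc_gE.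
  have [|v E] := tri_lift (u := fmap (tsh C) z) D.
    by rewrite compNl -fmapM gz fmap0 oppr0.
  have [y yE] := @tsh_full C T (heart_incl w (wc_term S 1)) v; exists y.
  by apply: tsh_inj; rewrite fmapM qE yE.
Qed.

(** [r] is the morphism W_{-1}[1] -> M_{-1}. The obstruction to extending a
    morphism W_{-1}[1] -> Y along it lies in C(W_{-2}[1], Y), which vanishes
    when Y has weights >= 0. *)
Lemma wc_coboundary :
  exists r : mor (tsh C (wc_trunc S (1 - 1 - 1)))
                 (heart_incl w (wc_term S (1 - 1 - 1))),
  ι (wc_d S (1 - 1)) = r ∘ wc_q0 /\
  forall Y (v : mor (tsh C (wc_trunc S (1 - 1 - 1))) Y), w_ge w 0 Y ->
    exists y, v = y ∘ r.
Proof.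
have [h D] := tsh_dist (wc_dist S (1 - 1 - 1)).
exists (shift_succ (1 - 1) _ ∘ fmap (tsh C) (wc_p S (1 - 1 - 1))); split.
  exact: wc_dE S (1 - 1).
move=> Y v YP; have [|y' ->] := tri_desc (u := v) D.
  have := shift_class_tsh (wc_trunc_le (1 - 1 - 1 - 1)); rewrite subrK => WP.
  exact: (w_orthn _ WP YP).
have [i [iE _]] :=
  shift_succ_iso (1 - 1) (heart_incl w (wc_term S (1 - 1 - 1))).
by exists (y' ∘ i); rewrite -mcompA; congr (_ ∘ _); rewrite mcompA iE comp1m.
Qed.
End WeightZero.

Section Kill.
Variables (M N : C) (g : mor M N).
Variables (S : weight_complex w M) (T : weight_complex w N).

Lemma kills_weight_wc n : kills_weight w n g <->
  exists u, g ∘ wc_arr S n = wc_arr T (n - 1) ∘ u.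
Proof.
have [R [b [c D]]] := wc_arrP S n.
have [R' [b' [c' D']]] := wc_arrP T (n - 1).
split=> [K|[u uE]].
  have [D't _ _] := D'.
  have [|u uE] := tri_lift (u := g ∘ wc_arr S n) D't; last by exists u.
  by rewrite mcompA (kills_weight_any K D D').
exists (wc_trunc S n), R, (wc_trunc T (n - 1)), R'.
exists (wc_arr S n), b, c, (wc_arr T (n - 1)), b', c'; split=> //.
by have [D't _ _] := D'; rewrite -mcompA uE mcompA (dist_comp0 D't) comp0m.
Qed.

Variable F : weight_complex_map S T g.

Lemma wm_p0 :
  ι (wm_term F (1 - 1)) ∘ wc_p0 S = wc_p0 T ∘ wm_trunc F (1 - 1).
Proof. exact: wm_p F (1 - 1). Qed.

(** Let u : W_0 -> V_{-1} lift W_0 -> M -> N. The difference between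
    [wm_trunc] and the image of u in V_0 vanishes in N, so it is q z with
    z : W_0 -> N_1, and z extends to x on M_0. Then t(g)_0 - d x vanishes on
    W_0, so it is induced from W_{-1}[1], where it extends to y on M_{-1}. *)
Lemma kills_weight0_null : kills_weight w (1 - 1) g ->
  exists (x : mor (wc_term S (1 - 1)) (wc_term T 1))
         (y : mor (wc_term S (1 - 1 - 1)) (wc_term T (1 - 1))),
    wm_term F (1 - 1) = wc_d T 1 ∘ x + y ∘ wc_d S (1 - 1).
Proof.
move=> /kills_weight_wc[u uE].
have [q [q0 dE qL]] := wc_boundary T; have [r [eE rL]] := wc_coboundary S.
have [||z zE] := qL _ (wm_trunc F (1 - 1) - wc_g T (1 - 1) ∘ u).
- exact: wc_trunc_le.
- by rewrite compBr wm_arr mcompA wc_gE uE; exact: subrr.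
have [|x xE] := tri_desc (u := z) (wc_dist0 S).
  exact: (w_orthn (n := 1 - 1 - 1) _ (wc_trunc_le S _) (wc_term_eq T 1).1).
have [|v vE] := tri_desc (u := ι (wm_term F (1 - 1)) - wc_p0 T ∘ q ∘ x)
    ((dist_rot _ _ _).1 (wc_dist0 S)).
  rewrite compBl -(mcompA _ x) -xE -mcompA -zE compBr mcompA.
  rewrite (dist_comp0 (wc_dist0 T)) comp0m subr0 wm_p0; exact: subrr.
have [y yE] := rL _ v (wc_term_eq T (1 - 1)).1.
exists x, y.
change (ι (wm_term F (1 - 1)) = ι (wc_d T 1) ∘ x + y ∘ ι (wc_d S (1 - 1))).
rewrite eE dE mcompA -yE -vE [RHS]addrC; exact/esym/subrK.
Qed.

(** If the cycle W_0 -> M_0 -> N_0 is the boundary of x, then [wm_trunc] minus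
    q x vanishes in N_0, so it lifts to V_{-1}; it still covers g because q
    vanishes in N. *)
Lemma kills_weight0_of_cycle :
  (exists x : mor (wc_trunc S (1 - 1)) (heart_incl w (wc_term T 1)),
     ι (wc_d T 1) ∘ x = ι (wm_term F (1 - 1)) ∘ wc_p0 S) ->
  kills_weight w (1 - 1) g.
Proof.
move=> [x xE]; apply/kills_weight_wc.
have [q [q0 dE _]] := wc_boundary T.
have [|u uE] := tri_lift (u := wm_trunc F (1 - 1) - q ∘ x) (wc_dist0 T).
  rewrite compBr -wm_p0 mcompA -xE dE; exact: subrr.
by exists u; rewrite -wc_gE -mcompA -uE compBr mcompA q0 comp0m subr0 wm_arr.
Qed.

(** Y is w_{>=0}N, and [phi] is induced by V_0 -> N -> Y, which vanishes on
    V_{-1}. If the cocycle [phi] becomes a coboundary on M_0, then it vanishes on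
    W_0, where it is the composite W_0 -> M -> N -> Y. *)
Lemma kills_weight0_of_cocycle :
  exists (Y : C) (phi : mor (heart_incl w (wc_term T (1 - 1))) Y),
  [/\ w_ge w 0 Y, phi ∘ ι (wc_d T 1) = 0 &
      (exists psi : mor (heart_incl w (wc_term S (1 - 1 - 1))) Y,
        phi ∘ ι (wm_term F (1 - 1)) = psi ∘ ι (wc_d S (1 - 1))) ->
      kills_weight w (1 - 1) g].
Proof.
have [R [b [c [D _ RP]]]] := wc_arrP T (1 - 1 - 1).
have [q [q0 dE _]] := wc_boundary T; have [r [eE _]] := wc_coboundary S.
have [|phi phiE] := tri_desc (u := b ∘ wc_arr T (1 - 1)) (wc_dist0 T).
  by rewrite -mcompA wc_gE (dist_comp0 D).
exists R, phi; split=> //; first by rewrite dE mcompA -phiE -mcompA q0 compm0.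
move=> [psi psiE]; apply/kills_weight_wc.
have [|u uE] := tri_lift (u := g ∘ wc_arr S (1 - 1)) D; last by exists u.
rewrite -(wm_arr F) mcompA phiE -mcompA -wm_p0 mcompA psiE eE -!mcompA.
by rewrite (dist_comp0' (wc_dist0 S)) !compm0.
Qed.
End Kill.

(** * Coproducts in the heart *)

(** Y_0 is w_{<=0}Y and K is (w_{>=1}Y)[-1]: orthogonality makes Y_0 -> Y
    surjective on morphisms from weights <= 0, and K again has weights >= 0, so
    that the construction can be repeated. *)
Lemma heart_cover (Y : C) : w_ge w 0 Y ->
  exists (Y0 : heart w) (e : mor (sval Y0) Y) (K : C) (k : mor K (sval Y0)),
  [/\ w_ge w 0 K, e ∘ k = 0,
      forall (X : C) (u : mor X Y), w_le w 0 X -> exists v, u = e ∘ v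
    & forall (X : C) (u : mor X (sval Y0)), e ∘ u = 0 -> exists v, u = k ∘ v].
Proof.
move=> YP; have [L [R [a [b [c [D LP RP]]]]]] := weight_decomp_exists w 0 Y.
have [Z [ZP [i [i' [i'i ii']]]]] := RP.
have [k kE] := @tsh_full C Z L (c ∘ i').
have LP' : w_eq w 0 L.
  split=> //; apply: (w_ge_orth (n := -1)) => X f XP.
  apply: (weight_decomp_arr_mono (And3 D LP RP) XP); exact: (w_orthn _ XP YP).
exists (exist _ L LP'), a, Z, k; split.
- by exists Z; split=> //; exact: isomorphic_refl.
- apply: tsh_inj; rewrite fmapM kE mcompA fmap0.
  have /dist_comp0 := (dist_rot _ _ _).1 ((dist_rot _ _ _).1 D).
  by rewrite compNl => /eqP; rewrite oppr_eq0 => /eqP ->; rewrite comp0m.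
- by move=> X u XP; apply: (tri_lift D); exact: (w_orthn _ XP RP).
- move=> X u au.
  have [|v vE] := tri_lift (u := fmap (tsh C) u)
    ((dist_rot _ _ _).1 ((dist_rot _ _ _).1 D)).
    by rewrite compNl -fmapM au fmap0 oppr0.
  have [v' v'E] := @tsh_full C X Z (i ∘ v); exists v'.
  by apply: tsh_inj; rewrite fmapM kE v'E mcompA -(mcompA c) i'i compm1.
Qed.

(** Covers Y_0 -> Y and K_0 -> K present C(-, Y) on the heart as the cokernel
    of C(-, K_0) -> C(-, Y_0): families of morphisms to Y, and families of
    relations between them, lift to the heart, where the coproduct property
    applies. *)
Lemma hom_to_coproducts (Y : C) :
  w_ge w 0 Y -> coproducts_to_products (hom_to w Y).
Proof.
move=> YP I X P i coP.
have le (Z : heart w) : w_le w 0 (sval Z) := (svalP Z).2.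
have [Y0 [e [K [k [KP ek eL kL]]]]] := heart_cover YP.
have [K0 [e' [_ [_ [_ _ e'L _]]]]] := heart_cover KP.
have lift (f : forall l, mor (sval (X l)) Y) :
    exists u : mor (sval P) Y, forall l, u ∘ ι (i l) = f l.
  have fL l : {v | f l = e ∘ v} by apply/cid/eL/le.
  have [u [uE _]] := coP Y0 (fun l => sval (fL l)).
  exists (e ∘ u) => l; rewrite -mcompA [X in _ ∘ X](uE l).
  exact/esym/(svalP (fL l)).
have unique (u : mor (sval P) Y) : (forall l, u ∘ ι (i l) = 0) -> u = 0.
  move=> u0; have [v vE] := eL _ u (le P).
  have vL l : {z | v ∘ ι (i l) = k ∘ e' ∘ z}.
    apply: cid; have [|z zE] := kL _ (v ∘ ι (i l)); first by rewrite mcompA -vE.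
    by have [z' z'E] := e'L _ z (le (X l)); exists z'; rewrite zE z'E mcompA.
  have [z [zE _]] := coP K0 (fun l => sval (vL l)).
  have [v' [_ v'U]] := coP Y0 (fun l => v ∘ ι (i l)).
  have E : v = k ∘ e' ∘ z.
    rewrite -(v'U v) // (v'U (k ∘ e' ∘ z)) // => l.
    by rewrite (svalP (vL l)) -(zE l) /= mcompA.
  by rewrite vE E !mcompA ek !comp0m.
move=> T f.
have fB (x : T) : {u : mor (sval P) Y |
    forall l, u ∘ ι (i l) = (f l : {additive _ -> _}) x}.
  exact/cid/lift.
have hB : zmod_morphism (fun x => sval (fB x)).
  move=> x y; apply/eqP; rewrite -subr_eq0; apply/eqP/unique => l.
  by rewrite !compBl !(svalP (fB _)) raddfB subrr.
exists (mk_additive hB); split=> [l|h hE].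
  by apply: additive_eq => x; exact: (svalP (fB x) l).
apply: additive_eq => x; apply/eqP; rewrite -subr_eq0; apply/eqP/unique => l.
by rewrite compBl /= (svalP (fB x)) -(hE l) subrr.
Qed.

(** * Pure functors and weight 0 *)

Section Pure.
Variables (t : weight_complex_choice w) (M N : C) (g : mor M N).

Lemma pure_cohom_map_null (AA : abelian)
    (A : add_functor (opcat (heart w)) AA) :
  kills_weight w (1 - 1) g -> pure_cohom_map A t g = 0.
Proof.
move/(kills_weight0_null (wcc_map t g)) => [x [y E]].
apply: (homology_map_null _ _ _ _ (s := cofmap A y) (r := cofmap A x)).
rewrite /cofmap E [RHS]addrC -!(fmapM A); exact: (fmapD A).
Qed.

Lemma pure_hom_map_null (AA : abelian) (A : add_functor (heart w) AA) :
  kills_weight w (1 - 1) g -> pure_hom_map A t g = 0.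
Proof.
move/(kills_weight0_null (wcc_map t g)) => [x [y E]].
apply: (homology_map_null _ _ _ _ (s := fmap A x) (r := fmap A y)).
by rewrite E fmapD !fmapM.
Qed.

Lemma kills_weight0_of_pure_cohom :
  (forall A : add_functor (opcat (heart w)) Ab,
    coproducts_to_products A -> pure_cohom_map A t g = 0) ->
  kills_weight w (1 - 1) g.
Proof.
move=> H.
have [Y [phi [YP phi0]]] := kills_weight0_of_cocycle (wcc_map t g); apply.
have [psi psiE] := homology_map_eq0_Ab (H _ (hom_to_coproducts YP)) phi0.
by exists psi; exact: esym psiE.
Qed.

Lemma kills_weight0_of_pure_hom :
  (forall A : add_functor (heart w) Ab, pure_hom_map A t g = 0) ->
  kills_weight w (1 - 1) g.
Proof.
move=> H; apply: (kills_weight0_of_cycle (F := wcc_map t g)).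
pose S := wcc_obj t M.
have p0 : ι (wc_d S (1 - 1)) ∘ wc_p0 S = 0.
  have [r [-> _]] := wc_coboundary S.
  by rewrite -mcompA (dist_comp0' (wc_dist0 S)) compm0.
exact: homology_map_eq0_Ab (H (hom_from w (wc_trunc S (1 - 1)))) p0.
Qed.
End Pure.
End Weights.

Theorem proposition2p4p4 (C : tricat) (w : weight_structure C)
    (t : weight_complex_choice w) (M N : C) (g : mor M N) (j : int) :
  [<-> kills_weight w j g;
       forall (AA : abelian) (A : add_functor (opcat (heart w)) AA),
         pure_cohom_map A t (fmap (shift C (- j)) g) = 0;
       forall A : add_functor (opcat (heart w)) Ab,
         coproducts_to_products A ->
         pure_cohom_map A t (fmap (shift C (- j)) g) = 0;
       forall (AA : abelian) (A : add_functor (heart w) AA),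
         pure_hom_map A t (fmap (shift C (- j)) g) = 0].
Proof.
have K : kills_weight w j g <->
    kills_weight w (1 - 1) (fmap (shift C (- j)) g).
  by rewrite subrr -(addNr j); exact: kills_weight_shift.
tfae=> [/K H AA A|H A _|H AA A|H].
- exact: pure_cohom_map_null.
- exact: H.
- exact/pure_hom_map_null/(kills_weight0_of_pure_cohom H).
- by apply/K/(kills_weight0_of_pure_hom (t := t)) => A; exact: H.
Qed.
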